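(* Let $(\mathfrak{g},[\cdot,\cdot],\delta)$ be a quasitriangular Lie bialgebra with classical $r$-matrix $r$ and let $\mathfrak{g}\ltimes V$ be a semidirect Lie bialgebra. Then $r$ defines a Poisson structure on the symmetric algebra $S(V)$, given on the generators $u,v\in V$ by $$\{u,v\}=r^-(u\otimes v),\qquad r^-=\tfrac12(r-r^{op}).$$
   Context: For vector spaces $A,B$, $A\wedge B\subset A\otimes B\oplus B\otimes A$ is the subspace of skew-symmetric elements. A Lie bialgebra is a Lie algebra $\mathfrak{a}$ with $\delta:\mathfrak{a}\to\mathfrak{a}\wedge\mathfrak{a}$ whose dual is a Lie bracket on $\mathfrak{a}^*$ and with $\delta([a,b])=[\delta(a),b\otimes1+1\otimes b]+[a\otimes1+1\otimes a,\delta(b)]$. A classical $r$-matrix is $r\in\mathfrak{g}\otimes\mathfrak{g}$ with $r+r^{op}$ $\mathfrak{g}$-invariant and $[r_{12},r_{13}]+[r_{12},r_{23}]+[r_{13},r_{23}]=0$ in $U(\mathfrak{g})^{\otimes3}$; $r^{op}$ is $r$ with tensor factors exchanged. $(\mathfrak{g},[\cdot,\cdot],\delta)$ is quasitriangular with $r$-matrix $r$ if $\delta(x)=[r,1\otimes x+x\otimes1]$ for all $x\in\mathfrak{g}$. A semidirect Lie bialgebra consists of a complex semisimple Lie algebra $\mathfrak{g}$, a finite-dimensional $\mathfrak{g}$-module $V$, and a Lie bialgebra structure on $\mathfrak{g}\ltimes V$ (the Lie algebra $\mathfrak{g}\oplus V$ with $[a+v,a'+v']=[a,a']+a.v'-a'.v$)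 such that $\mathfrak{g}$ with the restricted cobracket is a Lie subbialgebra and the cobracket maps $V$ into $V\wedge\mathfrak{g}$. Here the restricted cobracket on $\mathfrak{g}$ is the given $\delta$. The element $r^-\in\Lambda^2\mathfrak{g}$ acts on $V\otimes V$ through the two tensor factors, and $r^-(u\otimes v)$ is regarded as an element of $S^2V\subset S(V)$ (image under multiplication); the bracket is extended to $S(V)$ by the Leibniz rule. *)

(* Defs.v *)
From HB Require Import structures.
From mathcomp Require Import all_boot all_order all_algebra.
From mathcomp Require Import sesquilinear reals complex mpoly.
Set Implicit Arguments.
Unset Strict Implicit.
Unset Printing Implicit Defensive.
Import GRing.Theory.
Local Open Scope ring_scope.

(* Tensor products of finite-dimensional vector spaces.                     *)
(* A (x) B is modelled by matrices of coordinates in the library's bases    *)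
(* [vbasis fullv], a (x) b being the rank one matrix of coordinates.        *)
(* [tlift_tens] and [tens_ext] give the universal property, so that nothing *)
(* below depends on the choice of bases.                                    *)

Notation vdim A := (\dim (fullv : {vspace A})).
Notation tensor A B := 'M_(vdim A, vdim B).

Definition vcoord (K : fieldType) (A : vectType K) (i : 'I_(vdim A)) (a : A) :
  K := coord (vbasis fullv) i a.

Definition bvec (K : fieldType) (A : vectType K) (i : 'I_(vdim A)) : A :=
  (vbasis fullv)`_i.

Definition tens (K : fieldType) (A B : vectType K) (a : A) (b : B) :
  tensor A B := \matrix_(i, j) (vcoord i a * vcoord j b).

Definition tlift (K : fieldType) (A B : vectType K) (W : lmodType K)
    (f : A -> B -> W) (t : tensor A B) : W :=
  \sum_i \sum_j t i j *: f (bvec i) (bvec j).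

Definition is_bilinear (K : fieldType) (U V W : lmodType K)
  (f : U -> V -> W) : Prop := bilinear_for *:%R *:%R f.

Lemma vcoord_sum (K : fieldType) (A : vectType K) (a : A) :
  a = \sum_i vcoord i a *: bvec i.
Proof. exact: coord_vbasis (memvf a). Qed.

Lemma vcoord_bvec (K : fieldType) (A : vectType K) (i j : 'I_(vdim A)) :
  vcoord i (bvec j) = (i == j)%:R.
Proof.
by rewrite /vcoord coord_free ?(eq_sym j) //; apply: basis_free (vbasisP _).
Qed.

Lemma tlift_tens (K : fieldType) (A B : vectType K) (W : lmodType K)
    (f : A -> B -> W) (a : A) (b : B) :
  is_bilinear f -> tlift f (tens a b) = f a b.
Proof.
move=> [fl fr].
have suml (y : B) (c : 'I_(vdim A) -> K) :
    f (\sum_i c i *: bvec i) y = \sum_i c i *: f (bvec i) y.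
  pose g := HB.pack_for {linear A -> W} (f^~ y)
    (GRing.isLinear.Build K A W *:%R (f^~ y) (fl y)).
  rewrite -[LHS]/(g _) linear_sum.
  by apply: eq_bigr => i _; rewrite linearZ.
have sumr (x : A) (c : 'I_(vdim B) -> K) :
    f x (\sum_j c j *: bvec j) = \sum_j c j *: f x (bvec j).
  pose g := HB.pack_for {linear B -> W} (f x)
    (GRing.isLinear.Build K B W *:%R (f x) (fr x)).
  rewrite -[LHS]/(g _) linear_sum.
  by apply: eq_bigr => i _; rewrite linearZ.
rewrite [in RHS](vcoord_sum a) [in RHS](vcoord_sum b) suml /tlift.
apply: eq_bigr => i _; rewrite sumr scaler_sumr; apply: eq_bigr => j _.
by rewrite mxE scalerA.
Qed.

Lemma tens_ext (K : fieldType) (A B : vectType K) (W : lmodType K)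
    (f g : {linear tensor A B -> W}) :
  (forall a b, f (tens a b) = g (tens a b)) -> f =1 g.
Proof.
move=> fg t; rewrite (matrix_sum_delta t) !linear_sum; apply: eq_bigr => i _.
rewrite !linear_sum; apply: eq_bigr => j _; rewrite !linearZ /=; congr (_ *: _).
have -> : delta_mx i j = tens (bvec i) (bvec j).
  by apply/matrixP => k l; rewrite !mxE !vcoord_bvec -natrM mulnb.
exact: fg.
Qed.

Definition tswap (K : fieldType) (A B : vectType K) :
  tensor A B -> tensor B A := tlift (fun a b => tens b a).

Definition tmap (K : fieldType) (A B A' B' : vectType K)
    (f : A -> A') (h : B -> B') : tensor A B -> tensor A' B' :=
  tlift (fun a b => tens (f a) (h b)).

(* The image of P (x) Q in A (x) B. *)
Definition tensv (K : fieldType) (A B : vectType K)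
    (P : {vspace A}) (Q : {vspace B}) : {vspace tensor A B} :=
  <<[seq tens p q | p <- vbasis P, q <- vbasis Q]>>%VS.

(* Membership in P /\ Q, the skew-symmetric part of P (x) Q + Q (x) P, for
   subspaces P, Q of a common space E; P /\ P is Lambda^2 P. *)
Definition in_wedge (K : fieldType) (E : vectType K) (P Q : {vspace E})
    (t : tensor E E) : Prop :=
  tswap t = - t /\ t \in (tensv P Q + tensv Q P)%VS.

Definition is_lie_bracket (K : fieldType) (L : lmodType K)
    (br : L -> L -> L) : Prop :=
  [/\ is_bilinear br,
      forall x, br x x = 0 &
      forall x y z, br x (br y z) + br y (br z x) + br z (br x y) = 0].

Definition lie_ideal (K : fieldType) (L : vectType K) (br : L -> L -> L)
    (I : {vspace L}) : Prop := forall x y, y \in I -> br x y \in I.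

Definition derived (K : fieldType) (L : vectType K) (br : L -> L -> L)
    (U : {vspace L}) : {vspace L} :=
  <<[seq br x y | x <- vbasis U, y <- vbasis U]>>%VS.

Definition lie_solvable (K : fieldType) (L : vectType K) (br : L -> L -> L)
    (U : {vspace L}) : Prop := exists n, iter n (derived br) U = 0%VS.

Definition is_semisimple (K : fieldType) (L : vectType K)
    (br : L -> L -> L) : Prop :=
  is_lie_bracket br /\
  forall I, lie_ideal br I -> lie_solvable br I -> I = 0%VS.

Definition is_module (K : fieldType) (g V : vectType K) (br : g -> g -> g)
    (act : g -> V -> V) : Prop :=
  is_bilinear act /\
  forall a b v, act (br a b) v = act a (act b v) - act b (act a v).

Definition semidirect_bracket (K : fieldType) (g V : vectType K)
    (br : g -> g -> g) (act : g -> V -> V) (p q : g * V) : g * V :=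
  (br p.1 q.1, act p.1 q.2 - act q.1 p.2).

(* [x (x) 1 + 1 (x) x, t]; also [t, x (x) 1 + 1 (x) x] up to sign. *)
Definition ad2 (K : fieldType) (L : vectType K) (br : L -> L -> L)
    (x : L) : tensor L L -> tensor L L :=
  tlift (fun a b => tens (br x a) b + tens a (br x b)).

Definition dual_bracket (K : fieldType) (L : vectType K)
    (delta : L -> tensor L L) (xi eta : 'Hom(L, K^o)) : 'Hom(L, K^o) :=
  linfun (fun x => tlift (fun a b => xi a * eta b : K^o) (delta x)).

Definition is_lie_bialgebra (K : fieldType) (L : vectType K)
    (br : L -> L -> L) (delta : {linear L -> tensor L L}) : Prop :=
  [/\ is_lie_bracket br,
      forall x, in_wedge fullv fullv (delta x),
      is_lie_bracket (dual_bracket delta) &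
      forall a b, delta (br a b) = - ad2 br b (delta a) + ad2 br a (delta b)].

(* [r12,r13] + [r12,r23] + [r13,r23], where r12 = r (x) 1 etc. For          *)
(* r = sum a (x) b = sum a' (x) b' the three brackets in U(L)^(x)3 are      *)
(* sum [a,a'] (x) b (x) b', sum a (x) [b,a'] (x) b' and                     *)
(* sum a (x) a' (x) [b,b'], which lie in L^(x)3.                            *)
Definition cyb (K : fieldType) (L : vectType K) (br : L -> L -> L)
    (r : tensor L L) : tensor (tensor L L) L :=
  tlift (fun a b => tlift (fun a' b' =>
      tens (tens (br a a') b) b'
    + tens (tens a (br b a')) b'
    + tens (tens a a') (br b b')) r) r.

Definition is_classical_rmatrix (K : fieldType) (L : vectType K)
    (br : L -> L -> L) (r : tensor L L) : Prop :=
  (forall x, ad2 br x (r + tswap r) = 0) /\ cyb br r = 0.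

Definition is_quasitriangular (K : fieldType) (L : vectType K)
    (br : L -> L -> L) (delta : {linear L -> tensor L L})
    (r : tensor L L) : Prop :=
  [/\ is_lie_bialgebra br delta,
      is_classical_rmatrix br r &
      forall x, delta x = - ad2 br x r].

Definition inl_lin (K : fieldType) (g V : vectType K) (x : g) : g * V :=
  (x, 0).
Definition inr_lin (K : fieldType) (g V : vectType K) (v : V) : g * V :=
  (0, v).

Definition is_semidirect_lie_bialgebra (K : fieldType) (g V : vectType K)
    (br : g -> g -> g) (delta : {linear g -> tensor g g}) (act : g -> V -> V)
    (Delta : {linear (g * V)%type -> tensor (g * V)%type (g * V)%type}) : Prop :=
  [/\ is_semisimple br,
      is_module br act,
      is_lie_bialgebra (semidirect_bracket br act) Delta,
      forall x : g, Delta (inl_lin V x) =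
        tmap (@inl_lin K g V) (@inl_lin K g V) (delta x) &
      forall v : V, in_wedge (limg (linfun (@inr_lin K g V)))
                             (limg (linfun (@inl_lin K g V))) (Delta (inr_lin g v))].

(* S(V) is the polynomial algebra on the basis [vbasis fullv] of V, with V
   embedded by [sym_inj] as its degree one part. *)
Notation symalg V := {mpoly _[vdim V]}.

Definition sym_inj (K : fieldType) (V : vectType K) (v : V) :
  {mpoly K[vdim V]} := \sum_i vcoord i v *: 'X_i.

Definition sym_mul (K : fieldType) (V : vectType K) :
  tensor V V -> {mpoly K[vdim V]} :=
  tlift (fun u v => sym_inj u * sym_inj v).

Definition rminus (K : fieldType) (L : vectType K) (r : tensor L L) :
  tensor L L := 2%:R^-1 *: (r - tswap r).

Definition act2 (K : fieldType) (g V : vectType K) (act : g -> V -> V)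
    (r : tensor g g) (t : tensor V V) : tensor V V :=
  tlift (fun a b => tmap (act a) (act b) t) r.

Definition is_poisson_bracket (K : fieldType) (S : comAlgType K)
    (pb : S -> S -> S) : Prop :=
  is_lie_bracket pb /\
  forall f h k, pb f (h * k) = pb f h * k + h * pb f k.

(* Main.v *)
Require Import Defs.
From HB Require Import structures.
From mathcomp Require Import all_boot all_order all_algebra.
From mathcomp Require Import reals complex mpoly.
From mathcomp Require Import boolp spectral ring.
Set Implicit Arguments.
Unset Strict Implicit.
Unset Printing Implicit Defensive.
Import Order.TTheory GRing.Theory Num.Theory.
Local Open Scope ring_scope.

(** Fix a basis (e_a) of g, let r^- = sum_ab r_ab e_a (x) e_b be the skew part
    of the r-matrix and put f_a = sum_b r_ab e_b, so that the bracket reads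
    {u, v} = sum_a (e_a u)(f_a v). As r + r^op is invariant, the cobracket of g
    is delta(x) = - ad_x r^-.

    The component of Delta on V along e_a is an operator T_a of V. The heart of
    the proof is that semisimplicity leaves no freedom: T_a is the action of
    f_a ([coact_mx_rflat]), that is, Delta is the coboundary of r^- also on V.
    Put C_a = T_a - f_a. The cocycle condition on g x V says that C is
    g-equivariant, and on V x V it says that sum_a (e_a (x) C_a + C_a (x) e_a)
    vanishes on the skew part of V (x) V. Contract one tensor factor of the
    second condition with an operator P. For P = 1 the two mixed Casimir
    operators sum_a C_a e_a and sum_a e_a C_a add up to 0. For P = x in g this
    turns into
      sum_a (B_V + B_g)(e_a, x) C_a = - theta(x),
      theta(x) = sum_a tr(C_a x) e_a,
    with B_V the trace form of V and B_g the Killing form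
    ([weighted_form_equivariant]). The map theta commutes with the adjoint
    action, hence is symmetric for every invariant form because g is perfect;
    comparing, (2 B_V + B_g)(theta x, y) = 0 for all y. The form 2 B_V + B_g is
    nondegenerate, so theta = 0, and then C = 0 since B_V + B_g is nondegenerate
    too ([equivariant_skew_eq0]).

    Nondegeneracy is Cartan's criterion for the modules V^k (+) g
    ([cartan_criterion]). For x in [g, N], N the radical of the form, the trace
    of x against the conjugate of its semisimple part is both zero and the sum
    of the squared moduli of the eigenvalues of x, so ad x is nilpotent; by
    Engel's theorem ([engel]) a nonzero ideal of such elements would have a
    nonzero centre, against semisimplicity.

    Once T_a = f_a on V, the Jacobi identity of the dual bracket becomes
    [f_a, f_b] = - sum_c delta(e_c)_ab f_c on V. With the skewness of r^- this
    makes the Jacobi sum of three elements of V cancel cyclically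
    ([cyc_term_sum]). A bracket on a polynomial algebra that is a derivation in
    each argument is determined by its values on the variables, and so is its
    jacobiator; this gives existence ([biderivation_poisson]) and uniqueness
    ([poisson_unique]) on S(V). *)

(** * Conjugate of the semisimple part of a matrix *)

Section ConjPart.
Variable K : numClosedFieldType.

Lemma trig_mulmx n (A B : 'M[K]_n) : is_trig_mx A -> is_trig_mx B ->
  is_trig_mx (A *m B) /\ forall i, (A *m B) i i = A i i * B i i.
Proof.
move=> /is_trig_mxP tA /is_trig_mxP tB; split=> [|i].
  apply/is_trig_mxP => i j ltij; rewrite mxE big1 // => k _.
  have [ltik|leki] := ltnP i k; first by rewrite tA ?mul0r.
  by rewrite tB ?mulr0 // (leq_ltn_trans leki).
rewrite mxE (bigD1 i) //= big1 ?addr0 // => k; rewrite -val_eqE neq_ltn.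
by case/orP=> lt; [rewrite (tB _ _ lt) mulr0 | rewrite (tA _ _ lt) mul0r].
Qed.

Lemma trig_horner_mx n (A : 'M[K]_n.+1) (p : {poly K}) : is_trig_mx A ->
  is_trig_mx (horner_mx A p) /\ forall i, horner_mx A p i i = p.[A i i].
Proof.
move=> tA; elim/poly_ind: p => [|p c [tp dp]].
  by rewrite rmorph0; split=> [|i]; rewrite ?mx0_is_trig // horner0 mxE.
have [tpA dpA] := trig_mulmx tp tA.
rewrite rmorphD rmorphM /= horner_mx_X horner_mx_C; split=> [|i].
  apply/is_trig_mxP => i j ltij; rewrite mxE (is_trig_mxP tpA) // add0r.
  by apply/is_trig_mxP: i j ltij; apply: scalar_mx_is_trig.
by rewrite mxE dpA dp mxE eqxx !hornerE.
Qed.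

Lemma coprimep_horner_mx_eq0 n (A : 'M[K]_n.+1) (p q : {poly K}) (w : 'cV[K]_n.+1) :
  coprimep p q -> horner_mx A p *m w = 0 -> horner_mx A q *m w = 0 -> w = 0.
Proof.
move=> /Bezout_eq1_coprimepP [[u v] /= e] pw qw.
rewrite -[w]mul1mx -[1%:M](rmorph1 (horner_mx A)) -e rmorphD !rmorphM /=.
by rewrite mulmxDl -!mulmxA pw qw !mulmx0 addr0.
Qed.

Lemma coprimep_XsubC_prod (a : K) (s : seq K) N M : a \notin s ->
  coprimep (('X - a%:P) ^+ N) (\prod_(b <- s) ('X - b%:P) ^+ M).
Proof.
elim: s => [|b s IHs]; first by rewrite big_nil coprimep1.
rewrite inE negb_or big_cons coprimepMr => /andP [ab /IHs ->].
by rewrite andbT coprimep_expl ?coprimep_expr // coprimep_XsubC root_XsubC eq_sym.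
Qed.

Definition gen_eigenvector n (A : 'M[K]_n) (a : K) (w : 'cV[K]_n) : Prop :=
  exists N, (A - a%:M) ^+ N *m w = 0.

Lemma horner_XsubC_exp n (A : 'M[K]_n.+1) (a : K) N :
  horner_mx A (('X - a%:P) ^+ N) = (A - a%:M) ^+ N.
Proof. by rewrite rmorphXn rmorphB /= horner_mx_X horner_mx_C. Qed.

(** The powers of distinct X - a are pairwise coprime; one root is added at a
    time, with the correction supplied by a Bezout relation. *)
Lemma crt_poly (s : seq K) (c : K -> K) N : uniq s ->
  exists f : {poly K}, forall a, a \in s -> ('X - a%:P) ^+ N %| f - (c a)%:P.
Proof.
elim: s => [|a s IHs] /=; first by exists 0.
case/andP=> nsa /IHs [f fP].
have /Bezout_eq1_coprimepP [[u v] /=] := coprimep_XsubC_prod N N nsa.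
set q := \prod_(b <- s) _ => e.
exists (f + v * q * ((c a)%:P - f)) => b; rewrite inE.
case/predU1P=> [->|sb].
  have -> : f + v * q * ((c a)%:P - f) - (c a)%:P
    = u * (f - (c a)%:P) * ('X - a%:P) ^+ N.
    rewrite [RHS]mulrAC; move/(canRL (addrK _)): e => ->.
    by ring.
  exact: dvdp_mull.
rewrite addrAC dvdp_add ?fP // dvdp_mulr // dvdp_mull //.
by rewrite /q (big_rem b) //= dvdp_mulr.
Qed.

Lemma horner_mxM n (A : 'M[K]_n.+1) (p q : {poly K}) (w : 'cV[K]_n.+1) :
  horner_mx A (p * q) *m w = horner_mx A p *m (horner_mx A q *m w).
Proof. by rewrite rmorphM /= mulmxA. Qed.

Lemma horner_mx_dvd n (A : 'M[K]_n.+1) (p q : {poly K}) (w : 'cV[K]_n.+1) :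
  p %| q -> horner_mx A p *m w = 0 -> horner_mx A q *m w = 0.
Proof. by case/dvdpP=> r -> pw; rewrite horner_mxM pw mulmx0. Qed.

(** The characteristic polynomial splits, so every vector is a sum of
    generalized eigenvectors; an induction principle spares the choice of the
    spectral projections. *)
Lemma gen_eigenvector_ind n (A : 'M[K]_n) (P : 'cV[K]_n -> Prop) :
  (forall w w', P w -> P w' -> P (w + w')) ->
  (forall a w, gen_eigenvector A a w -> P w) -> forall w, P w.
Proof.
case: n A P => [|n] A P PD Pg w.
  by apply: (Pg 0); exists 0; rewrite (flatmx0 w) mulmx0.
have [r /esym] := closed_field_poly_normal (char_poly A).
rewrite (monicP (char_poly_monic A)) scale1r.
suff H (q : seq K) : horner_mx A (\prod_(z <- undup q) ('X - z%:P) ^+ size q) *m w = 0 -> P w.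
  move=> e; apply: (H r); apply: horner_mx_dvd (_ : char_poly A %| _) _.
    rewrite -e -[X in X %| _]prodr_undup_exp_count.
    elim: (undup r) => [|z s IH]; rewrite ?big_nil ?dvdpp // !big_cons.
    by rewrite dvdp_mul // dvdp_exp2l // count_size.
  by rewrite Cayley_Hamilton mul0mx.
move: (size q) (undup_uniq q) => N; elim: (undup q) w => [|a s IHs] w /=.
  rewrite big_nil rmorph1 mul1mx => _ ->.
  by apply: (Pg 0); exists 0; rewrite mulmx0.
case/andP=> nsa us; rewrite big_cons => kw.
have /Bezout_eq1_coprimepP [[u v] /=] := coprimep_XsubC_prod N N nsa.
set q' := \prod_(b <- s) _ in kw * => e.
have -> : w = horner_mx A (u * ('X - a%:P) ^+ N) *m w
            + horner_mx A (v * q') *m w.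
  by rewrite -mulmxDl -rmorphD /= e rmorph1 mul1mx.
apply: PD.
  apply: IHs => //; rewrite -horner_mxM.
  by apply: horner_mx_dvd kw; rewrite mulrCA dvdp_mull // mulrC.
apply: (Pg a); exists N; rewrite -horner_XsubC_exp -horner_mxM.
by apply: horner_mx_dvd kw; rewrite mulrCA dvdp_mull.
Qed.

(** [D] is the conjugate of the semisimple part of [A]. *)
Definition conj_part n (A D : 'M[K]_n) : Prop :=
  forall a w, gen_eigenvector A a w -> D *m w = a^* *: w.

(** [D] is a polynomial f(A), where the Chinese remainder theorem makes f
    congruent to the conjugate of a modulo a high power of X - a for each
    eigenvalue a. After triangularization the trace of D A is the sum of the
    squared moduli of the eigenvalues; if it vanishes, the characteristic
    polynomial is a power of X. *)
Lemma conj_part_exists n (A : 'M[K]_n) : exists D : 'M[K]_n,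
  [/\ conj_part A D, 0 <= \tr (D *m A) & \tr (D *m A) = 0 -> A ^+ n = 0].
Proof.
case: n A => [|n] A.
  by exists 0; split=> [a w _||_]; rewrite ?mul0mx ?linear0 ?(flatmx0 w) ?scaler0 // flatmx0.
have [r e] := closed_field_poly_normal (char_poly A).
rewrite (monicP (char_poly_monic A)) scale1r in e.
have [f fP] := crt_poly (fun a => a^*) n.+1 (undup_uniq r).
have sr : size r = n.+1.
  by have := size_char_poly A; rewrite e size_prod_XsubC => -[].
have cDA : conj_part A (horner_mx A f).
  (* By coprimality the exponent of a generalized eigenvector can be lowered to
     the multiplicity n.+1 that f takes into account. *)
  move=> a w [N kw].
  have [ra|nra] := boolP (a \in r); last first.
    suff -> : w = 0 by rewrite mulmx0 scaler0.
    apply: (@coprimep_horner_mx_eq0 _ A (char_poly A) (('X - a%:P) ^+ N)).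
    - by apply/coprimep_expr; rewrite coprimep_XsubC e root_prod_XsubC.
    - by rewrite Cayley_Hamilton mul0mx.
    - by rewrite horner_XsubC_exp.
  suff kw' : horner_mx A (('X - a%:P) ^+ n.+1) *m w = 0.
    apply/eqP; rewrite -subr_eq0 -mul_scalar_mx -(horner_mx_C A) -mulmxBl -rmorphB /=.
    by apply/eqP; apply: horner_mx_dvd kw'; rewrite fP // mem_undup.
  pose r' := [seq b <- r | b != a].
  apply: (@coprimep_horner_mx_eq0 _ A (\prod_(b <- r') ('X - b%:P)) (('X - a%:P) ^+ N)).
  - by apply/coprimep_expr; rewrite coprimep_XsubC root_prod_XsubC mem_filter eqxx.
  - rewrite -horner_mxM.
    apply: (@horner_mx_dvd _ _ (char_poly A)); last by rewrite Cayley_Hamilton mul0mx.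
    rewrite e (bigID (fun b => b != a)) /= big_filter dvdp_mul2l; last first.
      by rewrite -big_filter monic_neq0 // monic_prod_XsubC.
    rewrite (eq_bigr (fun=> 'X - a%:P)); last by move=> b /negPn /eqP ->.
    rewrite -big_filter big_const_seq count_predT iter_mulr_1.
    by apply: dvdp_exp2l; rewrite size_filter -sr count_size.
  - rewrite -horner_XsubC_exp in kw.
    by rewrite -horner_mxM mulrC horner_mxM kw mulmx0.
exists (horner_mx A f).
have [P Pu] := Schur A (ltn0Sn n); have Pun := unitarymx_unit Pu.
rewrite /similar_to /= conjumx // => tT; set T := P *m A *m invmx P in tT.
have [tfT dfT] := trig_horner_mx f tT.
have AE : A = invmx P *m T *m P by rewrite /T !mulmxA mulVmx // mul1mx mulmxKV.
have hAE p : horner_mx A p = invmx P *m horner_mx T p *m P.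
  rewrite /T -conjumx // horner_mx_conj ?row_free_unit ?stablemx_unit //.
  by rewrite conjumx // !mulmxA mulVmx // mul1mx mulmxKV.
have hT0 p : horner_mx A p = 0 -> horner_mx T p = 0.
  rewrite hAE => /(congr1 (fun M => P *m M *m invmx P)).
  by rewrite !mulmxA mulmxV // mul1mx mulmxK // mulmx0 mul0mx.
have eigT i : f.[T i i] = (T i i)^*.
  have rT : T i i \in r.
    rewrite -root_prod_XsubC -e rootE -(trig_horner_mx _ tT).2.
    by rewrite hT0 ?mxE // Cayley_Hamilton.
  have := fP (T i i); rewrite mem_undup => /(_ rT) /dvdpP [q fE].
  apply/eqP; rewrite -subr_eq0 -[X in _ - X](hornerC _ (T i i)) -hornerN -hornerD.
  by rewrite fE hornerM horner_exp hornerXsubC subrr expr0n mulr0.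
have trE : \tr (horner_mx A f *m A) = \sum_i `|T i i| ^+ 2.
  rewrite -{2}(horner_mx_X A) mulmxE -rmorphM /= hAE mxtrace_mulC !mulmxA mulmxV //.
  rewrite mul1mx; apply: eq_bigr => i _.
  by rewrite (trig_horner_mx _ tT).2 hornerM hornerX eigT mulrC normCK.
split=> //.
- by rewrite trE sumr_ge0 // => i _; rewrite exprn_ge0.
- rewrite trE => /psumr_eq0P tr0.
  have Tii i : T i i = 0.
    by apply/eqP; rewrite -normr_eq0 -sqrf_eq0 tr0 // => j _; rewrite exprn_ge0.
  rewrite -{1}(horner_mx_X A) -rmorphXn /= hAE.
  have -> : 'X ^+ n.+1 = char_poly T.
    rewrite char_poly_trig // (eq_bigr (fun=> 'X)) ?big_const_ord ?iter_mulr_1 //.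
    by move=> i _; rewrite Tii subr0.
  by rewrite Cayley_Hamilton mulmx0 mul0mx.
Qed.

(** Weights add up: M - (a + b) satisfies the Leibniz rule on [rho y *m v], with
    A - a acting on [y] and M - b on [v]. *)
Lemma gen_eigenvector_mul n m (A : 'M[K]_n) (M : 'M[K]_m)
    (rho : {linear 'cV[K]_n -> 'M[K]_m}) a b y v :
  (forall y, M *m rho y - rho y *m M = rho (A *m y)) ->
  gen_eigenvector A a y -> gen_eigenvector M b v -> gen_eigenvector M (a + b) (rho y *m v).
Proof.
move=> rhoA [N yN] [N' vN]; exists (N + N')%N.
move: {2}(N + N')%N (leqnn (N + N')) => k.
elim: k N N' y v yN vN => [|k IHk] N N' y v.
  rewrite leqn0 addn_eq0 => yN _ /andP [/eqP N0 /eqP N'0]; move: yN.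
  by rewrite N0 expr0 mul1mx => ->; rewrite linear0 mul0mx mulmx0.
case: N => [|N] yN vN.
  by rewrite expr0 mul1mx in yN; rewrite yN linear0 mul0mx mulmx0.
case: N' vN => [|N'] vN.
  by rewrite expr0 mul1mx in vN; rewrite vN !mulmx0.
rewrite !addSn ltnS => le; rewrite exprSr -mulmxE -mulmxA.
have -> : (M - (a + b)%:M) *m (rho y *m v)
    = rho ((A - a%:M) *m y) *m v + rho y *m ((M - b%:M) *m v).
  rewrite (mulmxBl A) linearB /= -rhoA !mul_scalar_mx linearZ /=.
  rewrite !mulmxBl !mulmxBr !mul_scalar_mx -!scalemxAl -!scalemxAr !mulmxA.
  by rewrite scalerDl opprD !addrA; congr (_ - _); rewrite [RHS]addrAC subrK.
have yN' : (A - a%:M) ^+ N *m ((A - a%:M) *m y) = 0.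
  by rewrite mulmxA mulmxE -exprSr.
have vN' : (M - b%:M) ^+ N' *m ((M - b%:M) *m v) = 0.
  by rewrite mulmxA mulmxE -exprSr.
rewrite mulmxDr (IHk _ _ _ _ yN' vN) ?add0r //.
by move: le; rewrite -addSnnS => le; rewrite (IHk _ _ _ _ yN vN').
Qed.

(** On weight vectors both sides multiply by the conjugate of a, because
    conjugation is additive and weights add up. *)
Lemma conj_part_bracket n m (A D : 'M[K]_n) (M E : 'M[K]_m)
    (rho : {linear 'cV[K]_n -> 'M[K]_m}) y :
  (forall y, M *m rho y - rho y *m M = rho (A *m y)) ->
  conj_part A D -> conj_part M E -> E *m rho y - rho y *m E = rho (D *m y).
Proof.
move=> rhoA AD ME; elim/(gen_eigenvector_ind (A := A)): y => [y y' IH IH'|a y ya].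
  by rewrite mulmxDr !linearD /= mulmxDl -IH -IH' opprD addrACA.
have H (v : 'cV_m) : (E *m rho y - rho y *m E - rho (D *m y)) *m v = 0.
  elim/(gen_eigenvector_ind (A := M)): v => [v v' IH IH'|b v vb].
    by rewrite mulmxDr IH IH' addr0.
  rewrite !mulmxBl -!mulmxA (ME _ _ (gen_eigenvector_mul rhoA ya vb)) (ME _ _ vb) (AD _ _ ya).
  rewrite [rho (_ *: _)]linearZ /= -scalemxAl -scalemxAr rmorphD scalerDl.
  by rewrite addrK subrr.
apply/eqP; rewrite -subr_eq0; apply/eqP/matrixP => i j.
by have /matrixP/(_ i 0) := H (delta_mx j 0); rewrite -colE !mxE.
Qed.
End ConjPart.

(** * Engel's theorem and semisimple Lie algebras *)

Section Bilinear.
Variables (K : fieldType) (U V W : lmodType K) (f : U -> V -> W).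
Hypothesis fb : is_bilinear f.

Lemma bilDl u u' v : f (u + u') v = f u v + f u' v.
Proof. by have [h _] := fb; have := h v 1 u u'; rewrite /= !scale1r. Qed.
Lemma bilDr u v v' : f u (v + v') = f u v + f u v'.
Proof. by have [_ h] := fb; have := h u 1 v v'; rewrite /= !scale1r. Qed.
Lemma bil0l v : f 0 v = 0.
Proof. by apply: (addrI (f 0 v)); rewrite -bilDl !addr0. Qed.
Lemma bil0r u : f u 0 = 0.
Proof. by apply: (addrI (f u 0)); rewrite -bilDr !addr0. Qed.
Lemma bilZl c u v : f (c *: u) v = c *: f u v.
Proof. by have [h _] := fb; have := h v c u 0; rewrite /= !addr0 bil0l addr0. Qed.
Lemma bilZr c u v : f u (c *: v) = c *: f u v.
Proof. by have [_ h] := fb; have := h u c v 0; rewrite /= !addr0 bil0r addr0. Qed.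
Lemma bilNl u v : f (- u) v = - f u v.
Proof. by rewrite -scaleN1r bilZl scaleN1r. Qed.
Lemma bilNr u v : f u (- v) = - f u v.
Proof. by rewrite -scaleN1r bilZr scaleN1r. Qed.
Lemma bilsuml I r (P : pred I) F v :
  f (\sum_(i <- r | P i) F i) v = \sum_(i <- r | P i) f (F i) v.
Proof. by apply: (big_morph (f^~ v)) => [u u'|]; rewrite ?bilDl ?bil0l. Qed.
Lemma bilsumr I r (P : pred I) F u :
  f u (\sum_(i <- r | P i) F i) = \sum_(i <- r | P i) f u (F i).
Proof. by apply: (big_morph (f u)) => [v v'|]; rewrite ?bilDr ?bil0r. Qed.
End Bilinear.

Lemma bilinear_intro (K : fieldType) (U V W : lmodType K) (f : U -> V -> W) :
  (forall u u' v, f (u + u') v = f u v + f u' v) ->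
  (forall c u v, f (c *: u) v = c *: f u v) ->
  (forall u v v', f u (v + v') = f u v + f u v') ->
  (forall c u v, f u (c *: v) = c *: f u v) -> is_bilinear f.
Proof.
by move=> Dl Zl Dr Zr; split=> u c x y /=; rewrite ?Dl ?Zl ?Dr ?Zr.
Qed.

(** Among the subspaces contained in [S], one of maximal dimension is all of
    [S]. *)
Lemma vspace_of_pred (K : fieldType) (L : vectType K) (S : L -> Prop) :
  S 0 -> (forall c u v, S u -> S v -> S (c *: u + v)) ->
  exists U : {vspace L}, forall v, v \in U <-> S v.
Proof.
move=> S0 SL.
pose P d := `[< exists U : {vspace L}, \dim U = d /\ forall v, v \in U -> S v >].
have exP : exists d, P d.
  by exists 0%N; apply/asboolP; exists 0%VS; rewrite dimv0; split=> // v /[1!memv0]/eqP ->.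
have ubP d : P d -> (d <= \dim {:L})%N.
  by move=> /asboolP [U [<- _]]; apply/dimvS/subvf.
case: (ex_maxnP exP ubP) => d /asboolP [U [dU US]] maxd; exists U => v.
split=> [/US //|Sv]; apply: contraT => nvU.
have /maxd : P (\dim (U + <[v]>)).
  apply/asboolP; exists (U + <[v]>)%VS; split=> // w /memv_addP [u uU [_ /vlineP [c ->]] ->].
  by rewrite addrC; apply: SL => //; apply: US.
by rewrite -dU leqNgt (ltn_leqif (dimv_leqif_sup (addvSl _ _))) subv_add subvv -memvE nvU.
Qed.

Section LieBracket.
Variables (K : fieldType) (g : lmodType K) (br : g -> g -> g).
Hypothesis brL : is_lie_bracket br.

Let brb : is_bilinear br. Proof. by case: brL. Qed.

Lemma lieC x y : br x y = - br y x.
Proof.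
have [_ alt _] := brL; apply/eqP; rewrite -addr_eq0; apply/eqP.
by have := alt (x + y); rewrite (bilDl brb) !(bilDr brb) !alt add0r addr0.
Qed.

Lemma lie_jacobi x y z : br x (br y z) = br (br x y) z + br y (br x z).
Proof.
have [_ _ /(_ x y z)] := brL.
rewrite [br z (br x y)]lieC [br z x]lieC (bilNr brb) => /eqP.
by rewrite subr_eq add0r => /eqP /(canRL (subrK _)).
Qed.

End LieBracket.

Section LieTheory.
Variables (K : fieldType) (g : vectType K) (br : g -> g -> g).
Hypothesis brL : is_lie_bracket br.

Let brb : is_bilinear br. Proof. by case: brL. Qed.

Definition ad_nilpotent x := forall y, exists k, iter k (br x) y = 0.

(** Induction on the dimension of [L], through a maximal proper subalgebra [U].
    The relative form, with a pair W0 < W in place of a quotient module, lets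
    the induction hypothesis apply to U acting on L modulo U, which gives x with
    L = U + <x>, and then to U acting on W modulo W0; a suitable iterate of x
    applied to the vector found last is sent into W0 by all of L. *)
Lemma engel (L W0 W : {vspace g}) :
  {in L &, forall x y, br x y \in L} -> {in L, forall x, ad_nilpotent x} ->
  (forall x w, x \in L -> w \in W0 -> br x w \in W0) ->
  (forall x w, x \in L -> w \in W -> br x w \in W) ->
  (exists2 w, w \in W & w \notin W0) ->
  exists2 w, w \in W & w \notin W0 /\ forall x, x \in L -> br x w \in W0.
Proof.
move: {2}(\dim L) (leqnn (\dim L)) => n.
elim: n L W0 W => [|n IHn] L W0 W dimL LL Lnil LW0 LW [w0 w0W w0W0].
  move: dimL; rewrite leqn0 dimv_eq0 => /eqP ->.
  by exists w0 => //; split=> // x /[1!memv0]/eqP ->; rewrite (bil0l brb) mem0v.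
have [L0|L0] := eqVneq L 0%VS.
  rewrite L0; exists w0 => //; split=> // x.
  by rewrite memv0 => /eqP ->; rewrite (bil0l brb) mem0v.
pose P d := `[< exists U : {vspace g}, [/\ \dim U = d, (U <= L)%VS, (U != L) &
  {in U &, forall x y, br x y \in U}] >].
have exP : exists d, P d.
  exists 0%N; apply/asboolP; exists 0%VS; rewrite dimv0 sub0v eq_sym; split=> // x y.
  by rewrite memv0 => /eqP -> _; rewrite (bil0l brb) mem0v.
have ubP d : P d -> (d <= \dim L)%N by move=> /asboolP [U [<- UL _ _]]; apply: dimvS.
case: (ex_maxnP exP ubP) => d /asboolP [U [dU UL nUL UU]] maxd.
have ltUL : (\dim U < \dim L)%N.
  by rewrite (ltn_leqif (dimv_leqif_eq UL)).
have leUn : (\dim U <= n)%N by rewrite -ltnS (leq_trans ltUL).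
have inUL x : x \in U -> x \in L by apply: (subvP UL).
have Unil : {in U, forall x, ad_nilpotent x} by move=> x /inUL/Lnil.
have [x xL [xU Ux]] : exists2 x, x \in L & x \notin U /\ forall u, u \in U -> br u x \in U.
  apply: IHn => //.
  - by move=> x w /inUL xL wL; apply: LL.
  - apply/subvPn; apply: contra nUL => LU; apply/eqP/subv_anti.
    by rewrite UL.
have LE : L = (U + <[x]>)%VS.
  apply/eqP; rewrite eq_sym; apply: contraT => nUx.
  have subUx : (U + <[x]> <= L)%VS by rewrite subv_add UL -memvE.
  have /maxd : P (\dim (U + <[x]>)).
    apply/asboolP; exists (U + <[x]>)%VS; split=> //.
    move=> _ _ /memv_addP [u uU [_ /vlineP [a ->]] ->] /memv_addP [v vU [_ /vlineP [b ->]] ->].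
    apply: (subvP (addvSl U _)).
    have [_ alt _] := brL.
    rewrite (bilDl brb) !(bilDr brb) !(bilZl brb) !(bilZr brb) alt !scaler0 addr0.
    have uv := UU u v uU vU; have xv : br x v \in U by rewrite (lieC brL) rpredN Ux.
    by rewrite !rpredD ?rpredZ ?Ux.
  rewrite -dU leqNgt (ltn_leqif (dimv_leqif_sup (addvSl _ _))).
  by rewrite subv_add subvv -memvE xU.
have [w1 w1W [w1W0 Uw1]] : exists2 w, w \in W & w \notin W0 /\ forall u, u \in U -> br u w \in W0.
  apply: IHn => //; last by exists w0.
  - by move=> u w /inUL; apply: LW0.
  - by move=> u w /inUL; apply: LW.
pose S w := w \in W /\ forall u, u \in U -> br u w \in W0.
have Sx w : S w -> S (br x w).
  move=> [wW Uw]; split=> [|u uU]; first exact: LW.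
  by rewrite (lie_jacobi brL) rpredD ?Uw ?Ux // LW0 ?Uw.
have Sit k : S (iter k (br x) w1) by elim: k => [|k IHk] //=; apply: Sx.
have exk : exists k, iter k (br x) w1 \in W0.
  by have [k kx] := Lnil x xL w1; exists k; rewrite kx mem0v.
case: (ex_minnP exk) => -[|k] /= kW0 mink; first by rewrite kW0 in w1W0.
have [kW Uk] := Sit k.
exists (iter k (br x) w1) => //; split=> [|y].
  by apply/negP => /mink; rewrite ltnn.
rewrite LE => /memv_addP [u uU [_ /vlineP [c ->]] ->].
by rewrite (bilDl brb) (bilZl brb) rpredD ?rpredZ ?kW0 ?Uk.
Qed.

(** By Engel's theorem a nonzero such [M] has a nonzero centre, which is an
    abelian ideal of the whole algebra. *)
Lemma ad_nilpotent_ideal_eq0 (M : {vspace g}) : is_semisimple br ->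
  (forall x y, y \in M -> br x y \in M) ->
  {in M, forall x, ad_nilpotent x} -> M = 0%VS.
Proof.
move=> [_ ss] Mi Mnil; apply/eqP; apply: contraT => M0.
have [Z ZP] : exists Z : {vspace g}, forall v,
    v \in Z <-> v \in M /\ forall x, x \in M -> br x v = 0.
  apply: vspace_of_pred => [|c u v [uM uZ] [vM vZ]].
    by split=> [|x _]; rewrite ?mem0v ?(bil0r brb).
  split=> [|x xM]; first by rewrite rpredD ?rpredZ.
  by rewrite (bilDr brb) (bilZr brb) uZ // vZ // scaler0 addr0.
have Z0 : Z = 0%VS.
  apply: ss => [x y /ZP [yM yZ]|].
    apply/ZP; split=> [|z zM]; first exact: Mi.
    by rewrite (lie_jacobi brL) (yZ z) // (bil0r brb) addr0 yZ // (lieC brL) rpredN Mi.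
  exists 1%N; apply/eqP; rewrite /= /derived -subv0.
  apply/span_subvP => _ /allpairsP [[x y] /= [xZ yZ ->]].
  have [[xM _] [_ yc]] := (proj1 (ZP x) (vbasis_mem xZ), proj1 (ZP y) (vbasis_mem yZ)).
  by rewrite yc ?mem0v.
have [w wM [w0 wZ]] : exists2 w, w \in M & w \notin 0%VS /\ forall x, x \in M -> br x w \in 0%VS.
  apply: engel => //.
  - by move=> x y _; apply: Mi.
  - by move=> x w _; rewrite memv0 => /eqP ->; rewrite (bil0r brb) mem0v.
  - by move=> x w _; apply: Mi.
  - by exists (vpick M); rewrite ?memv_pick // memv0 vpick0.
case/negP: w0; rewrite -Z0; apply/ZP; split=> // x /wZ.
by rewrite memv0 => /eqP.
Qed.

Lemma semisimple_center x : is_semisimple br -> (forall y, br y x = 0) -> x = 0.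
Proof.
move=> ss xc; apply/eqP; rewrite -memv0.
rewrite -(@ad_nilpotent_ideal_eq0 <[x]>) ?memv_line //.
  by move=> y _ /vlineP [c ->]; rewrite (bilZr brb) xc scaler0 mem0v.
move=> _ /vlineP [c ->] y; exists 1%N.
by rewrite /= (lieC brL) (bilZr brb) xc scaler0 oppr0.
Qed.

End LieTheory.

(** * Linear families of operators in coordinates *)

Section Coordinates.
Variable K : fieldType.

Definition cvec (A : vectType K) (a : A) : 'cV[K]_(vdim A) := \col_i vcoord i a.
Definition vecc (A : vectType K) (c : 'cV[K]_(vdim A)) : A := \sum_i c i 0 *: bvec i.
Definition op_mx (A B : vectType K) (f : A -> B) : 'M[K]_(vdim B, vdim A) :=
  \matrix_(i, j) vcoord i (f (bvec j)).

Lemma vcoordD (A : vectType K) i (a b : A) : vcoord i (a + b) = vcoord i a + vcoord i b.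
Proof. exact: linearD. Qed.
Lemma vcoordZ (A : vectType K) i c (a : A) : vcoord i (c *: a) = c * vcoord i a.
Proof. exact: linearZ. Qed.
Lemma vcoord_sumE (A : vectType K) i I r (P : pred I) (F : I -> A) :
  vcoord i (\sum_(k <- r | P k) F k) = \sum_(k <- r | P k) vcoord i (F k).
Proof. exact: linear_sum. Qed.

Lemma vcoord0 (A : vectType K) i : vcoord i (0 : A) = 0.
Proof. exact: linear0. Qed.

Lemma vec_ext (A : vectType K) (a b : A) : (forall i, vcoord i a = vcoord i b) -> a = b.
Proof.
by move=> ab; rewrite (vcoord_sum a) (vcoord_sum b); apply: eq_bigr => i _; rewrite ab.
Qed.

Lemma cvecK (A : vectType K) (a : A) : vecc (cvec a) = a.
Proof. by rewrite [RHS]vcoord_sum; apply: eq_bigr => i _; rewrite mxE. Qed.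

Lemma veccK (A : vectType K) (c : 'cV[K]_(vdim A)) : cvec (vecc c) = c.
Proof.
apply/colP => i; rewrite mxE vcoord_sumE (bigD1 i) //= big1 ?addr0 => [|j ji].
  by rewrite vcoordZ vcoord_bvec eqxx mulr1.
by rewrite vcoordZ vcoord_bvec eq_sym (negPf ji) mulr0.
Qed.

Lemma vecc_linear (A : vectType K) : linear (@vecc A).
Proof.
move=> k c d; rewrite /vecc scaler_sumr -big_split /=; apply: eq_bigr => i _.
by rewrite !mxE scalerDl scalerA.
Qed.

Section Family.
Variables (g V W : vectType K) (act : g -> V -> W).
Hypothesis actb : is_bilinear act.

Lemma op_mx_mul x v : cvec (act x v) = op_mx (act x) *m cvec v.
Proof.
apply/colP => i; rewrite !mxE {1}(vcoord_sum v) (bilsumr actb) vcoord_sumE.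
by apply: eq_bigr => j _; rewrite (bilZr actb) vcoordZ !mxE mulrC.
Qed.

Lemma op_mx_act i x v : vcoord i (act x v) = \sum_j op_mx (act x) i j * vcoord j v.
Proof.
have /colP/(_ i) := op_mx_mul x v; rewrite !mxE => ->.
by apply: eq_bigr => j _; rewrite !mxE.
Qed.

Lemma op_mx_linear : linear (fun x => op_mx (act x)).
Proof.
by move=> c x y; apply/matrixP => i j; rewrite !mxE (bilDl actb) (bilZl actb) vcoordD vcoordZ.
Qed.

Lemma op_mx0 : op_mx (act 0) = 0.
Proof. by apply/matrixP => i j; rewrite !mxE (bil0l actb) vcoord0. Qed.

Lemma op_mx_expand x : op_mx (act x) = \sum_a vcoord a x *: op_mx (act (bvec a)).
Proof.
apply/matrixP => i j; rewrite mxE {1}(vcoord_sum x) (bilsuml actb) vcoord_sumE summxE.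
by apply: eq_bigr => a _; rewrite (bilZl actb) vcoordZ !mxE.
Qed.
End Family.

Lemma span_ind (L : vectType K) (X : seq L) (P : L -> Prop) :
  P 0 -> (forall c u v, P u -> P v -> P (c *: u + v)) ->
  (forall x, x \in X -> P x) -> forall v, v \in <<X>>%VS -> P v.
Proof.
move=> P0 PL XP v vX; have [U UP] := vspace_of_pred P0 PL.
by apply/UP; apply: subvP vX; apply/span_subvP => x /XP/UP.
Qed.
End Coordinates.

(** * Cartan's criterion *)

Section TraceForm.
Variables (K : numClosedFieldType) (g V : vectType K).
Variables (br : g -> g -> g) (act : g -> V -> V).
Hypotheses (brL : is_lie_bracket br) (mod : is_module br act).

Let brb : is_bilinear br. Proof. by case: brL. Qed.
Let actb : is_bilinear act. Proof. by case: mod. Qed.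

Local Notation rho x := (op_mx (act x)).
Local Notation ad x := (op_mx (br x)).

Lemma op_mx_bracket x y : rho (br x y) = rho x *m rho y - rho y *m rho x.
Proof.
have [_ am] := mod; apply/matrixP => i j.
rewrite !mxE am -scaleN1r vcoordD vcoordZ mulN1r !(op_mx_act actb).
by congr (_ - _); apply: eq_bigr => k _; rewrite !mxE.
Qed.

Definition trace_form x y : K := \tr (rho x *m rho y).

Lemma trace_formC x y : trace_form x y = trace_form y x.
Proof. exact: mxtrace_mulC. Qed.

Lemma trace_form_inv x y z : trace_form (br x y) z = trace_form x (br y z).
Proof.
rewrite /trace_form !op_mx_bracket mulmxBl mulmxBr !linearB /= -!mulmxA; congr (_ - _).
by rewrite mxtrace_mulC -!mulmxA.
Qed.

Lemma trace_form_bil : is_bilinear (trace_form : g -> g -> K^o).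
Proof.
split=> x c y z; rewrite /trace_form /=; have := op_mx_linear actb c y z => /= ->.
  by rewrite mulmxDl -scalemxAl linearD linearZ.
by rewrite mulmxDr -scalemxAr linearD linearZ.
Qed.

(** tr(E [rho y, rho z]) = tr([E, rho y] rho z), and [E, rho y] = rho (D y) by
    [conj_part_bracket]. *)
Lemma trace_conj_part x y z (D : 'M[K]_(vdim g)) (E : 'M[K]_(vdim V)) :
  conj_part (ad x) D -> conj_part (rho x) E ->
  \tr (E *m rho (br y z)) = trace_form (vecc (D *m cvec y)) z.
Proof.
move=> cD cE.
have lin : linear (fun c => rho (vecc c)).
  by move=> c u v; rewrite vecc_linear (op_mx_linear actb).
pose r := HB.pack_for {linear 'cV[K]_(vdim g) -> 'M[K]_(vdim V)} (fun c => rho (vecc c))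
  (GRing.isLinear.Build K 'cV[K]_(vdim g) 'M[K]_(vdim V) *:%R (fun c => rho (vecc c)) lin).
have rA c : rho x *m r c - r c *m rho x = r (ad x *m c).
  by rewrite /= -op_mx_bracket -{2}(veccK c) -(op_mx_mul brb) cvecK.
rewrite /trace_form -[rho (vecc _)]/(r _) -(conj_part_bracket _ rA cD cE) /= cvecK.
rewrite op_mx_bracket mulmxBr mulmxBl !linearB /= !mulmxA; congr (_ - _).
by rewrite mxtrace_mulC mulmxA.
Qed.
End TraceForm.

Lemma adjoint_module (K : fieldType) (g : vectType K) (br : g -> g -> g) :
  is_lie_bracket br -> is_module br br.
Proof.
move=> brL; split; first by case: brL.
by move=> a b v; rewrite (lie_jacobi brL a b v) addrK.
Qed.

Section CartanCriterion.
Variables (K : numClosedFieldType) (g V : vectType K).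
Variables (br : g -> g -> g) (act : g -> V -> V).
Hypotheses (ss : is_semisimple br) (mod : is_module br act).

Let brL : is_lie_bracket br. Proof. by case: ss. Qed.
Let brb : is_bilinear br. Proof. by case: brL. Qed.
Let actb : is_bilinear act. Proof. by case: mod. Qed.
Let adj : is_module br br. Proof. exact: adjoint_module. Qed.

Local Notation rho x := (op_mx (act x)).
Local Notation ad x := (op_mx (br x)).

(** The trace form of the direct sum of [k] copies of V and the adjoint module.
    The weights 0, 1 and 2 are used below. *)
Definition weighted_form k x y : K := k%:R * trace_form act x y + trace_form br x y.
Local Notation F := weighted_form.

Lemma weighted_formC k x y : F k x y = F k y x.
Proof. by rewrite /F trace_formC (trace_formC br). Qed.

Lemma weighted_form_inv k x y z : F k (br x y) z = F k x (br y z).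
Proof. by rewrite /F (trace_form_inv mod) (trace_form_inv adj). Qed.

Lemma weighted_form_bil k : is_bilinear (F k : g -> g -> K^o).
Proof.
have [bl br'] := trace_form_bil mod; have [dl dr] := trace_form_bil adj.
split=> x c y z; rewrite /F /=.
  by rewrite (bl x c y z) (dl x c y z) scalerDr !mulrDr addrACA /GRing.scale /= mulrCA.
by rewrite (br' x c y z) (dr x c y z) scalerDr !mulrDr addrACA /GRing.scale /= mulrCA.
Qed.

Lemma ad_exp_eq0_nilpotent x : ad x ^+ vdim g = 0 -> ad_nilpotent br x.
Proof.
move=> nx y; exists (vdim g); rewrite -[LHS]cvecK -[RHS](@cvecK _ g); congr vecc.
suff -> k : cvec (iter k (br x) y) = ad x ^+ k *m cvec y.
  by rewrite nx mul0mx; apply/colP => i; rewrite !mxE vcoord0.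
elim: k => [|k IHk] /=; first by rewrite expr0 mul1mx.
by rewrite (op_mx_mul brb) IHk mulmxA mulmxE -exprS.
Qed.

(** Let N be the radical. For x in [g, N] the nonnegative traces of
    [conj_part_exists] on V and on g have a weighted sum that vanishes by
    [trace_conj_part], hence ad x is nilpotent. Thus [g, N] = 0, and N lies in
    the centre, which is zero. *)
Lemma cartan_criterion k x : (forall y, F k x y = 0) -> x = 0.
Proof.
have Fb := weighted_form_bil k.
have [N NP] : exists N : {vspace g}, forall v, v \in N <-> forall y, F k v y = 0.
  apply: vspace_of_pred => [y|c u v uN vN y]; first exact: (bil0l Fb).
  by rewrite (bilDl Fb) (bilZl Fb) uN vN scaler0 addr0.
pose M := <<[seq br y z | y <- vbasis {:g}, z <- vbasis N]>>%VS.
have brM y z : z \in N -> br y z \in M.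
  move=> zN; rewrite (coord_vbasis (memvf y)) (coord_vbasis zN).
  rewrite (bilsuml brb) rpred_sum // => i _; rewrite (bilsumr brb) rpred_sum // => j _.
  rewrite (bilZl brb) (bilZr brb) !rpredZ // memv_span // allpairs_f // mem_nth //.
    by rewrite size_tuple.
  by rewrite size_tuple.
have Mnil : {in M, forall y, ad_nilpotent br y}.
  move=> y yM.
  have [D [cD D0 Dnil]] := conj_part_exists (ad y).
  have [E [cE E0 _]] := conj_part_exists (rho y).
  have tr0 u : u \in M -> k%:R * \tr (E *m rho u) + \tr (D *m ad u) = 0.
    pose P u := k%:R * \tr (E *m rho u) + \tr (D *m ad u) = 0.
    move: u; apply: (@span_ind _ _ _ P) => [|c a b Pa Pb|_ /allpairsP [[a b] /= [_ bN ->]]].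
    - by rewrite /P (op_mx0 actb) (op_mx0 brb) !mulmx0 !linear0 mulr0 addr0.
    - rewrite /P (op_mx_linear actb c a b) (op_mx_linear brb c a b) !mulmxDr -!scalemxAr.
      rewrite !linearD !linearZ /= mulrDr addrACA mulrCA -mulrDr Pa Pb mulr0.
      by rewrite addr0.
    - rewrite /P (trace_conj_part brL mod a b cD cE) (trace_conj_part brL adj a b cD cD).
      rewrite -/(F k _ b) weighted_formC.
      by have /NP -> := vbasis_mem bN.
  apply/ad_exp_eq0_nilpotent/Dnil; apply/eqP; have /eqP := tr0 y yM.
  by rewrite paddr_eq0 ?mulr_ge0 ?ler0n // => /andP [].
have M0 : M = 0%VS.
  apply: (ad_nilpotent_ideal_eq0 brL ss) => // y z zM.
  apply: brM; apply: subvP zM; apply/span_subvP => _ /allpairsP [[a b] /= [_ bN ->]].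
  apply/NP => c; rewrite lieC // (bilNl Fb) weighted_form_inv //.
  by have /NP -> := vbasis_mem bN; rewrite oppr0.
move=> /NP xN; apply: (semisimple_center brL ss) => y.
by apply/eqP; rewrite -memv0 -M0 brM.
Qed.

(** A linear form is the Killing form against some t; if it vanishes on
    brackets then t is central by invariance. *)
Lemma semisimple_perfect (l : g -> K) : (forall c x y, l (c *: x + y) = c * l x + l y) ->
  (forall x y, l (br x y) = 0) -> forall x, l x = 0.
Proof.
move=> ll l0.
have Fb := weighted_form_bil 0.
pose G : 'M[K]_(vdim g) := \matrix_(a, b) F 0 (bvec a) (bvec b).
pose L := HB.pack_for {linear g -> K^o} (l : g -> K^o) (GRing.isLinear.Build K g K^o *:%R l ll).
have FE t x : F 0 t x = \sum_b (\sum_a vcoord a t * G a b) * vcoord b x.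
  rewrite {1}(vcoord_sum x) (bilsumr Fb); apply: eq_bigr => b _.
  rewrite (bilZr Fb) [RHS]mulrC; congr (_ * _).
  rewrite {1}(vcoord_sum t) (bilsuml Fb); apply: eq_bigr => a _.
  by rewrite (bilZl Fb) mxE.
have Gu : G \in unitmx.
  rewrite -row_free_unit -kermx_eq0; apply/rowV0P => u /sub_kermxP uG.
  have u0 : vecc u^T = 0 :> g.
    apply: (cartan_criterion (k := 0)) => x; rewrite FE big1 // => b _.
    have /rowP/(_ b) := uG; rewrite !mxE => e.
    rewrite (_ : \sum_a _ = 0) ?mul0r // -[RHS]e; apply: eq_bigr => a _.
    by have /colP/(_ a) := veccK (u^T); rewrite !mxE => ->.
  apply/rowP => a; have /colP/(_ a) := veccK (u^T); rewrite u0 !mxE => <-.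
  by rewrite vcoord0.
pose t : g := vecc ((\row_a l (bvec a)) *m invmx G)^T.
have lF x : l x = F 0 t x.
  have lE : l x = \sum_b l (bvec b) * vcoord b x.
    rewrite -[l x]/(L x) {1}(vcoord_sum x) linear_sum; apply: eq_bigr => b _.
    by rewrite linearZ /= mulrC.
  rewrite lE FE; apply: eq_bigr => b _; congr (_ * _).
  have /rowP/(_ b) := mulmxKV Gu (\row_a l (bvec a)); rewrite !mxE => <-.
  apply: eq_bigr => a _.
  by have /colP/(_ a) := veccK ((\row_a l (bvec a)) *m invmx G)^T; rewrite !mxE => ->.
have t0 : t = 0.
  apply: (semisimple_center brL ss) => y; rewrite lieC //.
  rewrite (cartan_criterion (k := 0) (x := br t y)) ?oppr0 // => z.
  by rewrite weighted_form_inv // -lF l0.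
by move=> x; rewrite lF t0 (bil0l Fb).
Qed.
End CartanCriterion.

(** * Equivariant families satisfying the skew condition vanish *)

Section Rigidity.
Variables (K : numClosedFieldType) (g V : vectType K).
Variables (br : g -> g -> g) (act : g -> V -> V).
Hypotheses (ss : is_semisimple br) (mod : is_module br act).

Let brL : is_lie_bracket br. Proof. by case: ss. Qed.
Let brb : is_bilinear br. Proof. by case: brL. Qed.
Let actb : is_bilinear act. Proof. by case: mod. Qed.
Let adj : is_module br br. Proof. exact: adjoint_module. Qed.

Local Notation rho x := (op_mx (act x)).
Local Notation ad x := (op_mx (br x)).
Local Notation X_ a := (op_mx (act (bvec a))).
Local Notation BV := (trace_form act).
Local Notation Bg := (trace_form br).
Local Notation F := (weighted_form br act).

Variable C : 'I_(vdim g) -> 'M[K]_(vdim V).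
Hypothesis C_equiv : forall x a, C a *m rho x - rho x *m C a = \sum_c ad x a c *: C c.
(* This is the vanishing of sum_a (X_ a (x) C a + C a (x) X_ a) on the skew part
   of V (x) V, contracted with P in one factor. *)
Hypothesis C_skew : forall P : 'M[K]_(vdim V),
  \sum_a (C a *m P *m X_ a + X_ a *m P *m C a)
  = \sum_a (\tr (C a *m P) *: X_ a + \tr (X_ a *m P) *: C a).

Lemma trace_action x : \tr (rho x) = 0.
Proof.
apply: (semisimple_perfect ss mod (l := fun x => \tr (rho x))) => [c u v|u v].
  by rewrite (op_mx_linear actb c u v) linearD linearZ.
by rewrite (op_mx_bracket mod) linearB /= mxtrace_mulC subrr.
Qed.

(** Taking traces in the equivariance relation shows that the vector with
    coordinates tr(C_a) is central. *)
Lemma trace_equiv a : \tr (C a) = 0.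
Proof.
pose t : g := vecc (\col_a \tr (C a)).
have t0 : t = 0.
  apply: (semisimple_center brL ss) => x.
  have adt : ad x *m cvec t = 0.
    rewrite veccK; apply/colP => b; rewrite !mxE.
    have /(congr1 mxtrace) := C_equiv x b; rewrite linearB /= mxtrace_mulC subrr linear_sum.
    move/esym=> e; rewrite -[RHS]e; apply: eq_bigr => c _.
    by rewrite !linearZ /= !mxE.
  apply: vec_ext => i; rewrite (op_mx_act brb) vcoord0; have /colP/(_ i) := adt.
  by rewrite !mxE => e; rewrite -[RHS]e; apply: eq_bigr => j _; rewrite !mxE.
by have /colP/(_ a) := veccK (\col_a \tr (C a)); rewrite -/t t0 !mxE vcoord0.
Qed.

(** The skew condition at P = 1, where all traces vanish. *)
Lemma casimir_sum0 : \sum_a C a *m X_ a + \sum_a X_ a *m C a = 0.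
Proof.
rewrite -big_split /=; have := C_skew 1%:M.
rewrite [RHS]big1 => [e|a _]; last first.
  by rewrite !mulmx1 trace_action trace_equiv !scale0r addr0.
by rewrite -[RHS]e; apply: eq_bigr => a _; rewrite !mulmx1.
Qed.

Lemma casimir_comm x : rho x *m (\sum_a X_ a *m C a) = (\sum_a X_ a *m C a) *m rho x.
Proof.
apply/eqP; rewrite -subr_eq0 mulmx_sumr mulmx_suml -sumrB; apply/eqP.
have e a : rho x *m (X_ a *m C a) - X_ a *m C a *m rho x
    = \sum_c (ad x c a *: (X_ c *m C a) - ad x a c *: (X_ a *m C c)).
  have -> : \sum_c (ad x c a *: (X_ c *m C a) - ad x a c *: (X_ a *m C c))
      = rho (br x (bvec a)) *m C a - X_ a *m (C a *m rho x - rho x *m C a).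
    rewrite C_equiv mulmx_sumr (op_mx_expand actb (br x _)) mulmx_suml -sumrB.
    by apply: eq_bigr => c _; rewrite -scalemxAl -scalemxAr mxE.
  rewrite (op_mx_bracket mod) mulmxBl mulmxBr !mulmxA opprB.
  by rewrite addrA subrK.
rewrite (eq_bigr _ (fun a _ => e a)).
under eq_bigr do rewrite sumrB.
by rewrite sumrB exchange_big /= subrr.
Qed.

(** The element of g that represents the linear forms xi |-> tr(C_xi x). *)
Definition theta x : g := vecc (\col_a \tr (C a *m rho x)).

Lemma vcoord_theta a x : vcoord a (theta x) = \tr (C a *m rho x).
Proof. by have /colP/(_ a) := veccK (\col_a \tr (C a *m rho x)); rewrite !mxE. Qed.

(** The skew condition at P = rho x. Moving rho x out of the middle of the products on the
    left leaves the two Casimir operators, which cancel, and commutator terms,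
    which equivariance sums up to the Killing form. *)
Lemma weighted_form_equivariant x : \sum_a F 1 (bvec a) x *: C a = - rho (theta x).
Proof.
have rxX a : rho x *m X_ a = X_ a *m rho x + rho (br x (bvec a)).
  by rewrite (op_mx_bracket mod) addrC subrK.
have lhs : \sum_a (C a *m rho x *m X_ a + X_ a *m rho x *m C a)
    = - \sum_c Bg (bvec c) x *: C c.
  have e a : C a *m rho x *m X_ a + X_ a *m rho x *m C a
      = C a *m X_ a *m rho x + rho x *m (X_ a *m C a)
        + \sum_c ad (br x (bvec a)) a c *: C c.
    have -> : C a *m rho x *m X_ a = C a *m X_ a *m rho x + C a *m rho (br x (bvec a)).
      by rewrite -mulmxA rxX mulmxDr mulmxA.
    have -> : X_ a *m rho x *m C a = rho x *m (X_ a *m C a) - rho (br x (bvec a)) *m C a.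
      by rewrite mulmxA rxX mulmxDl addrK.
    by rewrite -C_equiv addrACA.
  rewrite (eq_bigr _ (fun a _ => e a)) !big_split /= -mulmx_suml -mulmx_sumr.
  rewrite casimir_comm -mulmxDl casimir_sum0 mul0mx add0r exchange_big /= -sumrN.
  apply: eq_bigr => c _; rewrite -scaler_suml -scaleNr; congr (_ *: _).
  rewrite /trace_form -sumrN; apply: eq_bigr => a _.
  rewrite [LHS]mxE (lieC brL) -scaleN1r vcoordZ mulN1r (op_mx_act brb) mxE.
  by congr (- _); apply: eq_bigr => b _; rewrite !mxE.
have := C_skew (rho x); rewrite lhs big_split /= => /esym e.
rewrite (op_mx_expand actb (theta x)).
have -> : \sum_a vcoord a (theta x) *: X_ a = \sum_a \tr (C a *m rho x) *: X_ a.
  by apply: eq_bigr => a _; rewrite vcoord_theta.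
move/(canRL (addrK _)): e => ->.
rewrite opprB opprK -big_split /=; apply: eq_bigr => a _.
by rewrite /F mul1r scalerDl.
Qed.

Lemma theta_bracket x y : theta (br x y) = br x (theta y).
Proof.
apply: vec_ext => a; rewrite vcoord_theta (op_mx_act brb) (op_mx_bracket mod).
have -> : \tr (C a *m (rho x *m rho y - rho y *m rho x))
    = \tr ((C a *m rho x - rho x *m C a) *m rho y).
  rewrite mulmxBr mulmxBl !linearB /= !mulmxA; congr (_ - _).
  by rewrite -mulmxA mxtrace_mulC -mulmxA mxtrace_mulC.
rewrite C_equiv mulmx_suml linear_sum /=; apply: eq_bigr => c _.
by rewrite -scalemxAl linearZ vcoord_theta.
Qed.

Let Fb k := weighted_form_bil ss mod k.

Lemma theta_linear c x y : theta (c *: x + y) = c *: theta x + theta y.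
Proof.
apply: vec_ext => a; rewrite vcoordD vcoordZ !vcoord_theta.
by rewrite (op_mx_linear actb c x y) mulmxDr -scalemxAr linearD linearZ.
Qed.

(** A map commuting with the adjoint action can be passed through an invariant
    form when one argument is a bracket. *)
Lemma theta_sym x y : F 1 x (theta y) = F 1 (theta x) y.
Proof.
apply/eqP; rewrite -subr_eq0; apply/eqP; move: x.
apply: (semisimple_perfect ss mod) => [c u v|u v].
  rewrite theta_linear !(bilDl (Fb 1)) !(bilZl (Fb 1)) /GRing.scale /=.
  by rewrite mulrBr opprD addrACA.
have tvy : br (theta v) y = theta (br v y).
  have theta0 : theta 0 = 0.
    by apply: vec_ext => a; rewrite vcoord_theta (op_mx0 actb) mulmx0 linear0 vcoord0.
  rewrite lieC // -theta_bracket [br v y]lieC //.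
  by have := theta_linear (-1) (br y v) 0; rewrite !addr0 !scaleN1r theta0 addr0 => ->.
by rewrite theta_bracket !(weighted_form_inv ss mod) tvy -theta_bracket subrr.
Qed.

Lemma theta_eq0 x : theta x = 0.
Proof.
apply: (cartan_criterion ss mod (k := 2)) => y.
have -> : F 2 (theta x) y = BV (theta x) y + F 1 (theta x) y.
  by rewrite /F mul1r mulr_natl mulr2n addrA.
rewrite -theta_sym (vcoord_sum (theta y)) (bilsumr (Fb 1)).
have -> : \sum_a F 1 x (vcoord a (theta y) *: bvec a)
    = \tr ((\sum_a F 1 (bvec a) x *: C a) *m rho y).
  rewrite mulmx_suml linear_sum; apply: eq_bigr => a _.
  rewrite (bilZr (Fb 1)) vcoord_theta weighted_formC -scalemxAl linearZ /=.
  by rewrite /GRing.scale /= mulrC.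
by rewrite weighted_form_equivariant mulNmx linearN /= /trace_form subrr.
Qed.

(** With theta = 0 the entries of the C_a are the coordinates of elements of the
    radical of B_V + B_g. *)
Lemma equivariant_skew_eq0 a : C a = 0.
Proof.
have S0 x : \sum_a F 1 (bvec a) x *: C a = 0.
  by rewrite weighted_form_equivariant theta_eq0 (op_mx0 actb) oppr0.
apply/matrixP => i j; rewrite mxE.
pose t : g := vecc (\col_a C a i j).
have t0 : t = 0.
  apply: (cartan_criterion ss mod (k := 1)) => x.
  rewrite /t /vecc (bilsuml (Fb 1)).
  have /matrixP/(_ i j) := S0 x; rewrite summxE mxE => e; rewrite -[RHS]e.
  by apply: eq_bigr => b _; rewrite (bilZl (Fb 1)) !mxE /GRing.scale /= mulrC.
by have /colP/(_ a) := veccK (\col_a C a i j); rewrite -/t t0 !mxE vcoord0.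
Qed.
End Rigidity.

(** * Linear maps out of a tensor product *)

Section TensorLift.
Variable K : fieldType.
Local Notation tliftK := (@tlift K _ _ K^o).

Section Basic.
Variables (A B : vectType K) (W : lmodType K).
Implicit Types (f h : A -> B -> W) (s t : 'M[K]_(vdim A, vdim B)).

Lemma eq_tlift f h t : (forall a b, f a b = h a b) -> tlift f t = tlift h t.
Proof. by move=> fh; apply: eq_bigr => i _; apply: eq_bigr => j _; rewrite fh. Qed.

Lemma tlift_linear f c s t : tlift f (c *: s + t) = c *: tlift f s + tlift f t.
Proof.
rewrite /tlift scaler_sumr -big_split; apply: eq_bigr => i _ /=.
rewrite scaler_sumr -big_split; apply: eq_bigr => j _ /=.
by rewrite !mxE scalerDl scalerA.
Qed.

Lemma tlift0 f : tlift f 0 = 0.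
Proof. by rewrite /tlift big1 // => i _; rewrite big1 // => j _; rewrite mxE scale0r. Qed.

Lemma tliftD f s t : tlift f (s + t) = tlift f s + tlift f t.
Proof. by rewrite -[s]scale1r tlift_linear !scale1r. Qed.

Lemma tliftZ f c t : tlift f (c *: t) = c *: tlift f t.
Proof. by rewrite -[c *: t]addr0 tlift_linear tlift0 addr0. Qed.

Lemma tliftN f t : tlift f (- t) = - tlift f t.
Proof. by rewrite -(scaleN1r t) tliftZ scaleN1r. Qed.

Lemma tlift_addf f h t : tlift (fun a b => f a b + h a b) t = tlift f t + tlift h t.
Proof.
rewrite /tlift -big_split; apply: eq_bigr => i _ /=.
by rewrite -big_split; apply: eq_bigr => j _ /=; rewrite scalerDr.
Qed.

Lemma tlift_scalef c f t : tlift (fun a b => c *: f a b) t = c *: tlift f t.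
Proof.
rewrite /tlift scaler_sumr; apply: eq_bigr => i _ /=.
by rewrite scaler_sumr; apply: eq_bigr => j _ /=; rewrite !scalerA mulrC.
Qed.

Lemma tlift_zerof t : tlift (fun _ _ => 0 : W) t = 0.
Proof. by rewrite /tlift big1 // => i _; rewrite big1 // => j _; rewrite scaler0. Qed.

Lemma tlift_sumf I (r : seq I) (F : I -> A -> B -> W) t :
  tlift (fun a b => \sum_(k <- r) F k a b) t = \sum_(k <- r) tlift (F k) t.
Proof.
elim: r => [|k r IHr].
  by rewrite big_nil -[RHS](tlift_zerof t); apply: eq_tlift => a b; rewrite big_nil.
by rewrite big_cons -IHr -tlift_addf; apply: eq_tlift => a b; rewrite big_cons.
Qed.
End Basic.

(** Composition of universal maps; [tlift_ad2], [tlift_tmap] and [tlift_tswap]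
    are the instances that evaluate a form on the operations on tensors. *)
Lemma tlift_tlift (A B A' B' : vectType K) (W : lmodType K) (f : A' -> B' -> W)
  (h : A -> B -> tensor A' B') t :
  tlift f (tlift h t) = tlift (fun a b => tlift f (h a b)) t.
Proof.
rewrite [tlift h t]/tlift (big_morph _ (tliftD f) (tlift0 f)); apply: eq_bigr => i _.
rewrite (big_morph _ (tliftD f) (tlift0 f)); apply: eq_bigr => j _.
exact: tliftZ.
Qed.

Lemma tlift_ad2 (L : vectType K) (W : lmodType K) (br : L -> L -> L) (f : L -> L -> W) x t :
  is_bilinear f ->
  tlift f (ad2 br x t) = tlift (fun a b => f (br x a) b + f a (br x b)) t.
Proof.
by move=> fb; rewrite /ad2 tlift_tlift; apply: eq_tlift => a b; rewrite tliftD !tlift_tens.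
Qed.

Lemma tlift_tmap (A B A' B' : vectType K) (W : lmodType K) (f : A' -> B' -> W)
  (h : A -> A') (k : B -> B') t : is_bilinear f ->
  tlift f (tmap h k t) = tlift (fun a b => f (h a) (k b)) t.
Proof. by move=> fb; rewrite /tmap tlift_tlift; apply: eq_tlift => a b; rewrite tlift_tens. Qed.

Lemma tlift_tswap (A B : vectType K) (W : lmodType K) (f : B -> A -> W) t : is_bilinear f ->
  tlift f (tswap t) = tlift (fun a b => f b a) t.
Proof. by move=> fb; rewrite /tswap tlift_tlift; apply: eq_tlift => a b; rewrite tlift_tens. Qed.

Lemma mul_forms_bilinear (A B : vectType K) (al : A -> K) (be : B -> K) :
  scalar al -> scalar be -> is_bilinear (fun a b => al a * be b : K^o).
Proof.
move=> la lb; split=> [b c u v|a c u v] /=; rewrite ?la ?lb.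
  by rewrite mulrDl -mulrA.
by rewrite mulrDr mulrCA.
Qed.

Lemma vcoord_scalar (A : vectType K) i : scalar (@vcoord K A i).
Proof. by move=> c u v; rewrite vcoordD vcoordZ. Qed.

Lemma tlift_coord (A B : vectType K) (t : 'M[K]_(vdim A, vdim B)) i j :
  tliftK (fun a b => vcoord i a * vcoord j b) t = t i j.
Proof.
rewrite /tlift (bigD1 i) //= (bigD1 j) //= !vcoord_bvec !eqxx mulr1.
rewrite [X in _ + X + _]big1 => [|l lj]; last first.
  by rewrite !vcoord_bvec (eq_sym j) (negPf lj) mulr0 scaler0.
rewrite [X in _ + X]big1 => [|k ki]; first by rewrite !addr0 /GRing.scale /= mulr1.
by rewrite big1 // => l _; rewrite !vcoord_bvec (eq_sym i) (negPf ki) mul0r scaler0.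
Qed.

Lemma tlift_coordZ (A B : vectType K) (t : 'M[K]_(vdim A, vdim B)) c i j :
  c * t i j = tliftK (fun a b => c * (vcoord i a * vcoord j b)) t.
Proof. by rewrite -{1}tlift_coord -[LHS](@tlift_scalef _ _ K^o). Qed.

Lemma mul_vcoord_bilinear (A B : vectType K) i j :
  is_bilinear (fun (a : A) (b : B) => vcoord i a * vcoord j b : K^o).
Proof. by apply: mul_forms_bilinear; apply: vcoord_scalar. Qed.

Lemma tswapE (A B : vectType K) (t : 'M[K]_(vdim A, vdim B)) : tswap t = t^T.
Proof.
apply/matrixP => i j; rewrite -tlift_coord mxE tlift_tswap; last exact: mul_vcoord_bilinear.
by rewrite -[RHS]tlift_coord; apply: (@eq_tlift _ _ K^o) => a b; rewrite mulrC.
Qed.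

Lemma ad2E (L : vectType K) (br : L -> L -> L) x (t : tensor L L) : is_bilinear br ->
  ad2 br x t = op_mx (br x) *m t + t *m (op_mx (br x))^T.
Proof.
move=> brb; apply/matrixP => i j; rewrite -tlift_coord tlift_ad2; last exact: mul_vcoord_bilinear.
rewrite tlift_addf [RHS]mxE; congr (_ + _).
  rewrite [RHS]mxE; under [RHS]eq_bigr do rewrite tlift_coordZ.
  rewrite -(@tlift_sumf _ _ K^o); apply: (@eq_tlift _ _ K^o) => a b.
  by rewrite (op_mx_act brb) mulr_suml; apply: eq_bigr => k _; rewrite mulrA.
rewrite [RHS]mxE; under [RHS]eq_bigr do rewrite mulrC tlift_coordZ.
rewrite -(@tlift_sumf _ _ K^o); apply: (@eq_tlift _ _ K^o) => a b.
by rewrite (op_mx_act brb) mulr_sumr; apply: eq_bigr => k _; rewrite [in RHS]mxE mulrCA.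
Qed.
End TensorLift.

(** * The component of the cobracket in V and g *)

Lemma linfun_linE (K : fieldType) (A B : vectType K) (f : A -> B) :
  linear f -> linfun f =1 f.
Proof.
move=> lf x.
pose F := HB.pack_for {linear A -> B} f (GRing.isLinear.Build K A B *:%R f lf).
by rewrite -[RHS]/(F x) -(lfunE F).
Qed.

Lemma bilinear_ad2 (K : fieldType) (L W : lmodType K) (br : L -> L -> L)
    (f : L -> L -> W) x :
  is_bilinear br -> is_bilinear f -> is_bilinear (fun p q => f (br x p) q + f p (br x q)).
Proof.
move=> bb fb; apply: bilinear_intro => [u u' v|c u v|u v v'|c u v].
- by rewrite (bilDr bb) !(bilDl fb) addrACA.
- by rewrite (bilZr bb) !(bilZl fb) scalerDr.
- by rewrite (bilDr bb) !(bilDr fb) addrACA.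
- by rewrite (bilZr bb) !(bilZr fb) scalerDr.
Qed.

Section Coaction.
Variables (K : fieldType) (g V : vectType K).
Variables (br : g -> g -> g) (act : g -> V -> V).
Variables (delta : {linear g -> tensor g g}).
Variables (Delta : {linear (g * V)%type -> tensor (g * V)%type (g * V)%type}).
Local Notation L := (g * V)%type.
Local Notation sbr := (semidirect_bracket br act).
Local Notation tliftK := (@tlift K _ _ K^o).
Local Notation rho x := (op_mx (act x)).
Local Notation ad x := (op_mx (br x)).

Hypothesis brL : is_lie_bracket br.
Hypothesis mod : is_module br act.
Hypothesis bialg : is_lie_bialgebra sbr Delta.
Hypothesis Delta_g : forall x : g, Delta (inl_lin V x) =
        tmap (@inl_lin K g V) (@inl_lin K g V) (delta x).
Hypothesis Delta_V : forall v : V, in_wedge (limg (linfun (@inr_lin K g V)))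
                             (limg (linfun (@inl_lin K g V))) (Delta (inr_lin g v)).

Let brb : is_bilinear br. Proof. by case: brL. Qed.
Let actb : is_bilinear act. Proof. by case: mod. Qed.

Definition gcoord a (p : L) : K := vcoord a p.1.
Definition mcoord i (p : L) : K := vcoord i p.2.

Lemma gcoord_scalar a : scalar (gcoord a).
Proof. by move=> c p q; rewrite /gcoord vcoordD vcoordZ. Qed.
Lemma mcoord_scalar i : scalar (mcoord i).
Proof. by move=> c p q; rewrite /mcoord vcoordD vcoordZ. Qed.

(** Delta v has no component in g (x) g nor in V (x) V. The hypotheses on [f]
    say that it only sees these components. *)
Lemma tlift_Delta_V_eq0 (f : L -> L -> K) v : @is_bilinear K L L K^o f ->
  (forall x w, f (inl_lin V x) (inr_lin g w) = 0) ->
  (forall x w, f (inr_lin g w) (inl_lin V x) = 0) ->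
  tliftK f (Delta (inr_lin g v)) = 0.
Proof.
move=> fb f1 f2; have [_ /memv_addP [t tPQ [s sQP ->]]] := Delta_V v.
have inlE := @linfun_linE K g L (@inl_lin K g V).
have inrE := @linfun_linE K V L (@inr_lin K g V).
have inll : linear (@inl_lin K g V).
  by move=> c x y; rewrite /inl_lin; congr pair; rewrite /= scaler0 addr0.
have inrl : linear (@inr_lin K g V).
  by move=> c x y; rewrite /inr_lin; congr pair; rewrite /= scaler0 addr0.
have P0 : tliftK f 0 = 0 by apply: tlift0.
have PL c (u v' : 'M_(vdim L, vdim L)) :
    tliftK f u = 0 -> tliftK f v' = 0 -> tliftK f (c *: u + v') = 0.
  by move=> u0 v0; rewrite (@tlift_linear _ _ _ K^o) u0 v0 /GRing.scale /= mulr0 addr0.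
rewrite (@tliftD _ _ _ K^o).
have -> : tliftK f t = 0.
  move: t tPQ; apply: span_ind => // _ /allpairsP [[p q] /= [/vbasis_mem pP /vbasis_mem qQ ->]].
  move: pP qQ => /memv_imgP [w _ ->] /memv_imgP [x _ ->].
  by rewrite tlift_tens // inlE // inrE // f2.
have -> : tliftK f s = 0.
  move: s sQP; apply: span_ind => // _ /allpairsP [[p q] /= [/vbasis_mem pP /vbasis_mem qQ ->]].
  move: pP qQ => /memv_imgP [w _ ->] /memv_imgP [x _ ->].
  by rewrite tlift_tens // inlE // inrE // f1.
by rewrite addr0.
Qed.

(** The coefficient of Delta v at e_a (x) w_j, for (e_a) and (w_j) the bases of g
    and V. By skewness these coefficients determine Delta v. *)
Definition coact a j v : K := tliftK (fun p q => gcoord a p * mcoord j q) (Delta (inr_lin g v)).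

Lemma coact_swap a j v :
  tliftK (fun p q => mcoord j p * gcoord a q) (Delta (inr_lin g v)) = - coact a j v.
Proof.
have [sk _] := Delta_V v.
rewrite -[RHS](@tliftN _ _ _ K^o) -sk tlift_tswap; last first.
  by apply: mul_forms_bilinear; [apply: gcoord_scalar | apply: mcoord_scalar].
by apply: (@eq_tlift _ _ _ K^o) => p q; rewrite mulrC.
Qed.

Definition coact_mx a : 'M[K]_(vdim V) := \matrix_(j, l) coact a j (bvec l).

Lemma coactE a j v : coact a j v = \sum_l coact_mx a j l * vcoord l v.
Proof.
have -> : coact a j v = \sum_l vcoord l v * coact a j (bvec l).
  have inrl : linear (@inr_lin K g V).
    by move=> c x y; rewrite /inr_lin; congr pair; rewrite /= scaler0 addr0.
  have li : scalar (coact a j).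
    by move=> c x y; rewrite /coact inrl linearP (@tlift_linear _ _ _ K^o).
  pose F := HB.pack_for {scalar V} (coact a j) (GRing.isLinear.Build K V K^o *%R (coact a j) li).
  rewrite -[LHS]/(F v) {1}(vcoord_sum v) linear_sum; apply: eq_bigr => l _.
  by rewrite linearZ.
by apply: eq_bigr => l _; rewrite mxE mulrC.
Qed.

Lemma sbr_gV x v : sbr (inl_lin V x) (inr_lin g v) = inr_lin g (act x v).
Proof. by congr pair; rewrite /= ?(bil0r brb) // (bil0l actb) subr0. Qed.

Lemma sbr_VV u v : sbr (inr_lin g u) (inr_lin g v) = 0.
Proof. by congr pair; rewrite /= ?(bil0r brb) // !(bil0l actb) subr0. Qed.

Let sbrb : is_bilinear sbr. Proof. by case: bialg => -[]. Qed.

(** The component at e_a (x) w_j of the cocycle identity for [x, v]. *)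
Lemma coact_act a j x v : coact a j (act x v)
  = \sum_b delta x a b * vcoord j (act (bvec b) v)
   + (\sum_c ad x a c * coact c j v + \sum_k rho x j k * coact a k v).
Proof.
have [_ _ _ cocyc] := bialg.
have fb : @is_bilinear K L L K^o (fun p q => gcoord a p * mcoord j q).
  by apply: mul_forms_bilinear; [apply: gcoord_scalar | apply: mcoord_scalar].
rewrite /coact -sbr_gV cocyc (@tliftD _ _ _ K^o) (@tliftN _ _ _ K^o).
rewrite !(@tlift_ad2 _ _ K^o) //; congr (_ + _).
  apply/eqP; rewrite eqr_oppLR -sumrN; apply/eqP.
  rewrite Delta_g (@tlift_tmap _ _ _ _ _ K^o); last exact: (@bilinear_ad2 K L K^o _ _ _ sbrb fb).
  under [RHS]eq_bigr do rewrite mulrC -mulNr tlift_coordZ.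
  rewrite -(@tlift_sumf _ _ _ K^o); apply: (@eq_tlift _ _ _ K^o) => p q.
  rewrite /gcoord /mcoord /= (bil0l actb) vcoord0 mulr0 !add0r -scaleN1r vcoordZ mulN1r mulrN.
  rewrite {1}(vcoord_sum q) (bilsuml actb) vcoord_sumE mulr_sumr -sumrN.
  by apply: eq_bigr => b _; rewrite (bilZl actb) vcoordZ; ring.
rewrite (@tlift_addf _ _ _ K^o); congr (_ + _).
  under [RHS]eq_bigr do rewrite -[_ * _](@tlift_scalef _ _ _ K^o).
  rewrite -(@tlift_sumf _ _ _ K^o); apply: (@eq_tlift _ _ _ K^o) => p q.
  rewrite /gcoord /= (op_mx_act brb) mulr_suml; apply: eq_bigr => k _.
  by rewrite /GRing.scale /= mulrA.
under [RHS]eq_bigr do rewrite -[_ * _](@tlift_scalef _ _ _ K^o).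
rewrite -(@tlift_sumf _ _ _ K^o); apply: (@eq_tlift _ _ _ K^o) => p q.
rewrite /mcoord /= (bil0r actb) subr0 (op_mx_act actb) mulr_sumr; apply: eq_bigr => k _.
by rewrite /GRing.scale /= mulrCA.
Qed.

Lemma coact_mx_equivariant x a : coact_mx a *m rho x - rho x *m coact_mx a
  = \sum_b delta x a b *: rho (bvec b) + \sum_c ad x a c *: coact_mx c.
Proof.
apply/matrixP => j l.
have -> : coact_mx a *m rho x = \matrix_(j, l) coact a j (act x (bvec l)).
  by apply/matrixP => j' l'; rewrite !mxE coactE; apply: eq_bigr => k _; rewrite !mxE.
apply/eqP; rewrite !mxE subr_eq coact_act addrA; apply/eqP; congr (_ + _ + _).
- by rewrite summxE; apply: eq_bigr => b _; rewrite !mxE.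
- by rewrite summxE; apply: eq_bigr => c _; rewrite !mxE.
- by apply: eq_bigr => k _; rewrite !mxE.
Qed.

(** The V (x) V component of [v, Delta u], where v acts by moving the g factor
    of Delta u into V. *)
Lemma tlift_ad_V i j u v :
  tliftK (fun p q => mcoord i p * mcoord j q) (ad2 sbr (inr_lin g v) (Delta (inr_lin g u)))
  = - \sum_a (vcoord i (act (bvec a) v) * coact a j u - vcoord j (act (bvec a) v) * coact a i u).
Proof.
have fb : @is_bilinear K L L K^o (fun p q => mcoord i p * mcoord j q).
  by apply: mul_forms_bilinear; apply: mcoord_scalar.
have sbrV k p : mcoord k (sbr (inr_lin g v) p) = - \sum_a gcoord a p * vcoord k (act (bvec a) v).
  rewrite /mcoord /= (bil0l actb) sub0r -scaleN1r vcoordZ mulN1r; congr (- _).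
  rewrite {1}(vcoord_sum p.1) (bilsuml actb) vcoord_sumE.
  by apply: eq_bigr => a _; rewrite (bilZl actb) vcoordZ.
rewrite (@tlift_ad2 _ _ K^o) // sumrB opprB addrC -sumrN (@tlift_addf _ _ _ K^o).
congr (_ + _).
  under [RHS]eq_bigr do rewrite -mulNr -[_ * _](@tlift_scalef _ _ _ K^o).
  rewrite -(@tlift_sumf _ _ _ K^o); apply: (@eq_tlift _ _ _ K^o) => p q.
  rewrite sbrV -sumrN mulr_suml; apply: eq_bigr => a _.
  by rewrite /GRing.scale /=; ring.
under [RHS]eq_bigr do rewrite -mulrNN -coact_swap -[_ * _](@tlift_scalef _ _ _ K^o).
rewrite -(@tlift_sumf _ _ _ K^o); apply: (@eq_tlift _ _ _ K^o) => p q.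
rewrite sbrV -sumrN mulr_sumr; apply: eq_bigr => a _.
by rewrite /GRing.scale /=; ring.
Qed.

(** The V (x) V component of the cocycle identity for [u, v] = 0. *)
Lemma coact_mx_skew i j k l :
  \sum_a (rho (bvec a) i k * coact_mx a j l - rho (bvec a) j k * coact_mx a i l
   - rho (bvec a) i l * coact_mx a j k + rho (bvec a) j l * coact_mx a i k) = 0.
Proof.
have [_ _ _ cocyc] := bialg.
have := congr1 (tliftK (fun p q => mcoord i p * mcoord j q))
  (cocyc (inr_lin g (bvec l)) (inr_lin g (bvec k))).
rewrite sbr_VV linear0 (@tlift0 _ _ _ K^o) (@tliftD _ _ _ K^o) (@tliftN _ _ _ K^o).
rewrite !tlift_ad_V opprK -sumrB => e; rewrite [RHS]e.
by apply: eq_bigr => a _; rewrite !mxE; ring.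
Qed.

Lemma dual_bracketE (xi eta : 'Hom(L, K^o)) p :
  dual_bracket Delta xi eta p = tliftK (fun a b => xi a * eta b) (Delta p).
Proof.
rewrite /dual_bracket linfun_linE // => c x y.
by rewrite linearP (@tlift_linear _ _ _ K^o).
Qed.

(** The dual of V is a module over the Lie algebra dual to g: this is the Jacobi
    identity of the dual bracket for two coordinate forms on g and one on V. *)
Lemma coact_mx_commutator a b : coact_mx a *m coact_mx b - coact_mx b *m coact_mx a
  = - \sum_c delta (bvec c) a b *: coact_mx c.
Proof.
have [_ _ dL _] := bialg; have [dbb _ djac] := dL.
pose xi a : 'Hom(L, K^o) := linfun (gcoord a : L -> K^o).
pose om i : 'Hom(L, K^o) := linfun (mcoord i : L -> K^o).
have xiE c p : xi c p = gcoord c p by rewrite linfun_linE //; apply: gcoord_scalar.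
have omE i p : om i p = mcoord i p by rewrite linfun_linE //; apply: mcoord_scalar.
have split_p p : p = inl_lin V p.1 + inr_lin g p.2 :> L.
  by case: p => x v; congr pair; rewrite /= ?addr0 ?add0r.
have omN k l : om k (inr_lin g (bvec l)) = (k == l)%:R by rewrite omE /mcoord /= vcoord_bvec.
have mixed c i : dual_bracket Delta (xi c) (om i) = \sum_k coact_mx c i k *: om k.
  apply/lfunP => p; rewrite dual_bracketE sum_lfunE [in LHS](split_p p) linearD.
  rewrite (@tliftD _ _ _ K^o) Delta_g (@tlift_tmap _ _ _ _ _ K^o); last first.
    by apply: mul_forms_bilinear => t u v; rewrite linearP.
  rewrite (@eq_tlift _ _ _ K^o _ (fun _ _ => 0)); last first.
    by move=> u v; rewrite omE /mcoord /= vcoord0 mulr0.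
  rewrite (@tlift_zerof _ _ _ K^o) add0r.
  rewrite (@eq_tlift _ _ _ K^o _ (fun p q => gcoord c p * mcoord i q)); last first.
    by move=> u v; rewrite xiE omE.
  rewrite -[LHS]/(coact c i p.2) coactE; apply: eq_bigr => k _.
  by rewrite lfunE /= omE.
have pure c d : dual_bracket Delta (xi c) (xi d) = \sum_e delta (bvec e) c d *: xi e.
  apply/lfunP => p; rewrite dual_bracketE sum_lfunE [in LHS](split_p p) linearD.
  rewrite (@tliftD _ _ _ K^o) Delta_g (@tlift_tmap _ _ _ _ _ K^o); last first.
    by apply: mul_forms_bilinear => t u v; rewrite linearP.
  rewrite [X in _ + X]tlift_Delta_V_eq0; last first.
  - by move=> x w; rewrite xiE /gcoord /= vcoord0 mul0r.
  - by move=> x w; rewrite !xiE /gcoord /= vcoord0 mulr0.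
  - by apply: mul_forms_bilinear => t u v; rewrite linearP.
  rewrite addr0 (@eq_tlift _ _ _ K^o _ (fun p q => vcoord c p * vcoord d q)); last first.
    by move=> u v; rewrite !xiE.
  rewrite tlift_coord {1}(vcoord_sum p.1) linear_sum summxE; apply: eq_bigr => e _.
  by rewrite linearZ lfunE /= xiE mxE mulrC.
have jac := djac (xi a) (xi b) (om _).
have ev c d i l : dual_bracket Delta (xi c) (dual_bracket Delta (xi d) (om i)) (inr_lin g (bvec l))
    = (coact_mx d *m coact_mx c) i l.
  rewrite mixed (bilsumr dbb) sum_lfunE mxE; apply: eq_bigr => k _.
  rewrite (bilZr dbb) lfunE /= mixed sum_lfunE; congr (_ * _).
  rewrite (bigD1 l) //= big1 => [|m ml]; last by rewrite lfunE /= omN (negPf ml) scaler0.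
  by rewrite lfunE /= omN eqxx addr0 /GRing.scale /= mulr1.
apply/matrixP => i l.
have /lfunP/(_ (inr_lin g (bvec l))) := jac i.
rewrite !add_lfunE zero_lfunE ev [dual_bracket Delta (om i) (xi a)](lieC dL).
rewrite (bilNr dbb) opp_lfunE ev.
rewrite pure (bilsumr dbb) sum_lfunE.
have -> : \sum_e dual_bracket Delta (om i) (delta (bvec e) a b *: xi e) (inr_lin g (bvec l))
    = - \sum_e delta (bvec e) a b * coact_mx e i l.
  rewrite -sumrN; apply: eq_bigr => e _.
  rewrite (bilZr dbb) (lieC dL) mixed scalerN opp_lfunE lfunE /= sum_lfunE.
  congr (- (_ * _)); rewrite (bigD1 l) //= big1 => [|m ml].
    by rewrite lfunE /= omN eqxx addr0 /GRing.scale /= mulr1.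
  by rewrite lfunE /= omN (negPf ml) scaler0.
move=> e; rewrite [LHS]mxE [(- (_ *m _)) _ _]mxE [RHS]mxE summxE.
under [in RHS]eq_bigr do rewrite mxE.
apply/eqP; rewrite -subr_eq0 -oppr_eq0 -[X in _ == X]e; apply/eqP; ring.
Qed.
End Coaction.

(** * The cobracket on V is the coboundary of the skew r-matrix *)

Section SemidirectCobracket.
Variables (K : numClosedFieldType) (g V : vectType K).
Variables (br : g -> g -> g) (act : g -> V -> V).
Variables (delta : {linear g -> tensor g g}) (r : 'M[K]_(vdim g)).
Variables (Delta : {linear (g * V)%type -> tensor (g * V)%type (g * V)%type}).
Local Notation rho x := (op_mx (act x)).
Local Notation ad x := (op_mx (br x)).
Local Notation X_ a := (op_mx (act (bvec a))).

Hypothesis quasi : is_quasitriangular br delta r.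
Hypothesis semid : is_semidirect_lie_bialgebra br delta act Delta.

Let ss : is_semisimple br. Proof. by case: semid. Qed.
Let mod : is_module br act. Proof. by case: semid. Qed.
Let brL : is_lie_bracket br. Proof. by case: ss. Qed.
Let brb : is_bilinear br. Proof. by case: brL. Qed.
Let actb : is_bilinear act. Proof. by case: mod. Qed.

Local Notation rm := (rminus r).

Lemma rminus_skew a b : rm a b = - rm b a.
Proof. by rewrite /rminus tswapE !mxE -mulrN opprB. Qed.

(** The symmetric part of [r] is invariant and does not contribute. *)
Lemma delta_rminus x : delta x = - (ad x *m rm + rm *m (ad x)^T).
Proof.
have [_ [inv _] ->] := quasi; rewrite -!ad2E //; congr (- _).
have {1}-> : r = rm + 2%:R^-1 *: (r + tswap r).
  rewrite /rminus -scalerDr addrACA addNr addr0 -mulr2n -scaler_nat scalerA mulVf ?scale1r //.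
  by rewrite pnatr_eq0.
have adD c s t : ad2 br x (s + c *: t) = ad2 br x s + c *: ad2 br x t.
  by rewrite /ad2 tliftD tliftZ.
by rewrite adD inv scaler0 addr0.
Qed.

(** The matrix of the action of f_a. *)
Definition rflat a : 'M[K]_(vdim V) := \sum_b rm a b *: X_ b.

(** The defect of [Delta] from being the coboundary of the skew r-matrix. *)
Let coC a := coact_mx Delta a - rflat a.

Lemma coact_mx_sub_rflat_equivariant x a :
  coC a *m rho x - rho x *m coC a = \sum_c ad x a c *: coC c.
Proof.
have [_ _ bialg Dg DV] := semid.
have e := coact_mx_equivariant brL mod bialg Dg x a.
have f : rflat a *m rho x - rho x *m rflat a = - \sum_c (rm *m (ad x)^T) a c *: X_ c.
  transitivity (- \sum_b rm a b *: rho (br x (bvec b))).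
    rewrite mulmx_suml mulmx_sumr -sumrB -sumrN; apply: eq_bigr => b _.
    by rewrite (op_mx_bracket mod) -scalemxAl -scalemxAr -scalerBr -scalerN opprB.
  congr (- _); under eq_bigr do rewrite (op_mx_expand actb) scaler_sumr.
  rewrite exchange_big /=; apply: eq_bigr => c _; rewrite mxE scaler_suml.
  by apply: eq_bigr => b _; rewrite scalerA !mxE.
have h : \sum_b (ad x *m rm) a b *: X_ b = \sum_c ad x a c *: rflat c.
  under [RHS]eq_bigr do rewrite scaler_sumr.
  rewrite exchange_big /=; apply: eq_bigr => b _; rewrite mxE scaler_suml.
  by apply: eq_bigr => c _; rewrite scalerA.
have -> : coC a *m rho x - rho x *m coC a
    = (coact_mx Delta a *m rho x - rho x *m coact_mx Delta a)
      - (rflat a *m rho x - rho x *m rflat a).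
  by rewrite /coC mulmxBl mulmxBr !opprB addrACA [RHS]addrACA [X in _ + X = _]addrC.
rewrite e f opprK.
have -> : \sum_b delta x a b *: X_ b
    = - \sum_c ad x a c *: rflat c - \sum_c (rm *m (ad x)^T) a c *: X_ c.
  rewrite -h -opprD -big_split -sumrN; apply: eq_bigr => b _.
  have -> : delta x a b = - ((ad x *m rm) a b + (rm *m (ad x)^T) a b).
    by rewrite delta_rminus mxE [X in - X]mxE.
  by rewrite scaleNr scalerDl.
rewrite addrAC subrK addrC -sumrB; apply: eq_bigr => c _.
by rewrite scalerBr.
Qed.

(** Contraction of one of the two tensor factors with [P]. *)
Lemma skew_entries_trace (X C : 'I_(vdim g) -> 'M[K]_(vdim V)) :
  (forall i j k l, \sum_a (X a i k * C a j l - X a j k * C a i l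
     - X a i l * C a j k + X a j l * C a i k) = 0) ->
  forall P : 'M[K]_(vdim V), \sum_a (C a *m P *m X a + X a *m P *m C a)
  = \sum_a (\tr (C a *m P) *: X a + \tr (X a *m P) *: C a).
Proof.
move=> XC P; apply/matrixP => j l; rewrite !summxE; apply/eqP; rewrite -subr_eq0 -sumrB.
have e3 (A B : 'M[K]_(vdim V)) : (A *m P *m B) j l = \sum_i \sum_k P k i * (A j k * B i l).
  rewrite mxE; apply: eq_bigr => i _; rewrite mxE mulr_suml; apply: eq_bigr => k _; ring.
have et (A : 'M[K]_(vdim V)) : \tr (A *m P) = \sum_i \sum_k P k i * A i k.
  by rewrite /mxtrace; apply: eq_bigr => i _; rewrite mxE; apply: eq_bigr => k _; rewrite mulrC.
have ez (A B : 'M[K]_(vdim V)) : (\tr (A *m P) *: B) j l = \sum_i \sum_k P k i * (A i k * B j l).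
  rewrite mxE et mulr_suml; apply: eq_bigr => i _; rewrite mulr_suml.
  by apply: eq_bigr => k _; rewrite mulrA.
rewrite (eq_bigr (fun a => - \sum_i \sum_k P k i * (X a i k * C a j l - X a j k * C a i l
     - X a i l * C a j k + X a j l * C a i k))).
  rewrite sumrN exchange_big /= big1 ?oppr0 // => i _; rewrite exchange_big /= big1 // => k _.
  by rewrite -mulr_sumr XC mulr0.
have mxD (A B : 'M[K]_(vdim V)) : (A + B) j l = A j l + B j l by rewrite mxE.
move=> a _; rewrite !mxD !e3 !ez -!big_split /= -!sumrB -sumrN.
apply: eq_bigr => i _; rewrite -!big_split /= -sumrB -sumrN; apply: eq_bigr => k _; ring.
Qed.

(** The coboundary of the skew r-matrix is a cocycle with the same values on g,
    so the difference inherits both cocycle conditions and vanishes by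
    [equivariant_skew_eq0]. *)
Lemma coact_mx_rflat a : coact_mx Delta a = rflat a.
Proof.
have [_ _ bialg Dg DV] := semid.
apply/eqP; rewrite -subr_eq0 -/(coC a); apply/eqP.
apply: (equivariant_skew_eq0 ss mod) a.
  exact: coact_mx_sub_rflat_equivariant.
apply: (skew_entries_trace (X := fun a => X_ a)) => i j k l.
have e := coact_mx_skew brL mod bialg DV i j k l.
have f : \sum_a (X_ a i k * rflat a j l - X_ a j k * rflat a i l
     - X_ a i l * rflat a j k + X_ a j l * rflat a i k) = 0.
  have s i' j' k' l' : \sum_a X_ a i' k' * rflat a j' l' + \sum_a X_ a j' l' * rflat a i' k' = 0.
    have st i1 j1 k1 l1 : \sum_a X_ a i1 k1 * rflat a j1 l1 =
       \sum_a \sum_b rm a b * (X_ a i1 k1 * X_ b j1 l1).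
      apply: eq_bigr => a _; rewrite summxE mulr_sumr; apply: eq_bigr => b _.
      by rewrite [X in _ * X]mxE mulrCA.
    rewrite !st addrC exchange_big /= -big_split big1 // => a _; rewrite -big_split big1 //= => b _.
    by rewrite (rminus_skew b a); ring.
  transitivity ((\sum_a X_ a i k * rflat a j l + \sum_a X_ a j l * rflat a i k)
     - (\sum_a X_ a i l * rflat a j k + \sum_a X_ a j k * rflat a i l)).
    by rewrite -!big_split -sumrB; apply: eq_bigr => b _ /=; ring.
  by rewrite !s subrr.
move: e f; set S := \sum_a _; set S' := \sum_a _ => e f.
transitivity (S - S'); last by rewrite e f subrr.
rewrite -sumrB; apply: eq_bigr => b _.
have mxB i' j' : coC b i' j' = coact_mx Delta b i' j' - rflat b i' j' by rewrite !mxE.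
by rewrite !mxB; ring.
Qed.

(** The module relation of [coact_mx_commutator], now that the coaction is the
    action of the f_a. *)
Lemma rflat_mx_commutator a b : rflat a *m rflat b - rflat b *m rflat a
  = \sum_c (ad (bvec c) *m rm + rm *m (ad (bvec c))^T) a b *: rflat c.
Proof.
have [_ _ bialg Dg DV] := semid.
rewrite -!coact_mx_rflat (coact_mx_commutator bialg Dg DV) -sumrN; apply: eq_bigr => c _.
by rewrite coact_mx_rflat -scaleNr delta_rminus [X in - X]mxE opprK.
Qed.
End SemidirectCobracket.

(** * The cyclic identity *)

Section CyclicIdentity.
Variables (K : fieldType) (g : vectType K) (br : g -> g -> g) (S : comAlgType K).
Variable rm : 'M[K]_(vdim g).
Hypothesis brL : is_lie_bracket br.
Hypothesis rm_skew : forall a b, rm a b = - rm b a.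
Let brb : is_bilinear br. Proof. by case: brL. Qed.

Local Notation e_ := (@bvec K g).
Definition flat a : g := \sum_b rm a b *: bvec b.

(** Both sides pair [Phi] with sum_ab r_ab e_a (x) e_b, up to the skew sign. *)
Lemma skew_swap (Phi : g -> g -> S) : is_bilinear Phi ->
  \sum_a Phi (e_ a) (flat a) = - \sum_a Phi (flat a) (e_ a).
Proof.
move=> Pb; rewrite -sumrN.
under eq_bigr do rewrite (bilsumr Pb).
under [RHS]eq_bigr do rewrite (bilsuml Pb) -sumrN.
rewrite exchange_big; apply: eq_bigr => a _; apply: eq_bigr => b _ /=.
by rewrite (bilZl Pb) (bilZr Pb) rm_skew scaleNr.
Qed.

Lemma skew_swap_mul (f h : g -> S) (x : S) : linear f -> linear h ->
  \sum_a f (e_ a) * h (flat a) * x = - \sum_a f (flat a) * h (e_ a) * x.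
Proof.
move=> lf lh; apply: (skew_swap (Phi := fun p q => f p * h q * x)).
split=> [q c u v|p c u v] /=; rewrite ?lf ?lh.
  by rewrite !mulrDl -!scalerAl.
by rewrite mulrDr mulrDl -scalerAr -scalerAl.
Qed.

(** With al x = x u, be x = x v and ga x = x w, this is the part of the Jacobi
    sum of u, v, w in which two operators hit w. *)
Definition cyc_term (al be ga : g -> S) : S :=
  \sum_a \sum_b al (e_ a) * be (e_ b) * ga (br (flat a) (flat b)).

(** The relation replaces the bracket [f_a, f_b] in the first term by the action
    of e_c on sum_ab r_ab e_a (x) e_b, which splits into a bracket in the first
    slot and one in the second. By skewness e and f may be exchanged in each
    summation index, at the cost of a sign, and the two sums become minus the
    two other cyclic terms. *)
Lemma cyc_term_sum (al be ga : {linear g -> S}) :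
  (forall a b, ga (br (flat a) (flat b))
     = \sum_c (op_mx (br (e_ c)) *m rm + rm *m (op_mx (br (e_ c)))^T) a b *: ga (flat c)) ->
  cyc_term al be ga + cyc_term be ga al + cyc_term ga al be = 0.
Proof.
move=> rel.
have brE c d : br (e_ c) (e_ d) = \sum_a op_mx (br (e_ c)) a d *: e_ a.
  by rewrite {1}(vcoord_sum (br _ _)); apply: eq_bigr => a _; rewrite mxE.
have sumD2 (P Q : 'I_(vdim g) -> 'I_(vdim g) -> S) :
    \sum_a \sum_b (P a b + Q a b) = \sum_a \sum_b P a b + \sum_a \sum_b Q a b.
  by rewrite -big_split; apply: eq_bigr => a _; rewrite -big_split.
have step : cyc_term al be ga =
    \sum_c (\sum_d al (br (e_ c) (e_ d)) * be (flat d) * ga (flat c))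
  + \sum_c (\sum_d al (e_ d) * be (br (e_ c) (flat d)) * ga (flat c)).
  rewrite -big_split /=.
  transitivity (\sum_c \sum_a \sum_b
     ((op_mx (br (e_ c)) *m rm) a b *: (al (e_ a) * be (e_ b) * ga (flat c))
     + (rm *m (op_mx (br (e_ c)))^T) a b *: (al (e_ a) * be (e_ b) * ga (flat c)))).
    rewrite /cyc_term [RHS]exchange_big /=; apply: eq_bigr => a _.
    rewrite [RHS]exchange_big /=; apply: eq_bigr => b _.
    rewrite rel mulr_sumr; apply: eq_bigr => c _.
    by rewrite mxE -scalerAr scalerDl.
  apply: eq_bigr => c _.
  rewrite sumD2; congr (_ + _).
    under [RHS]eq_bigr do rewrite brE linear_sum !mulr_suml.
    rewrite [RHS]exchange_big; apply: eq_bigr => a _ /=.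
    under eq_bigr do rewrite mxE scaler_suml.
    rewrite exchange_big; apply: eq_bigr => d _ /=.
    rewrite linearZ [flat d]/flat (linear_sum be) mulr_sumr mulr_suml; apply: eq_bigr => b _ /=.
    by rewrite linearZ -!scalerAl -scalerAr -scalerAl scalerA.
  apply: eq_bigr => a _.
  have -> : br (e_ c) (flat a) = \sum_b (rm *m (op_mx (br (e_ c)))^T) a b *: e_ b.
    rewrite /flat (bilsumr brb).
    under eq_bigr do rewrite (bilZr brb) brE scaler_sumr.
    rewrite exchange_big; apply: eq_bigr => b _ /=; rewrite mxE scaler_suml.
    by apply: eq_bigr => d _; rewrite scalerA [in RHS]mxE.
  rewrite (linear_sum be) mulr_sumr mulr_suml; apply: eq_bigr => b _ /=.
  by rewrite linearZ -scalerAr -scalerAl.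
have lbr1 (f : {linear g -> S}) z : linear (fun p => f (br p z)).
  by move=> c u v; rewrite (bilDl brb) (bilZl brb) linearP.
have lbr2 (f : {linear g -> S}) z : linear (fun p => f (br z p)).
  by move=> c u v; rewrite (bilDr brb) (bilZr brb) linearP.
have lf (f : {linear g -> S}) : linear f by move=> c u v; rewrite linearP.
have p1 : \sum_c (\sum_d al (br (e_ c) (e_ d)) * be (flat d) * ga (flat c)) = - cyc_term be ga al.
  rewrite exchange_big /=.
  under eq_bigr do under eq_bigr do rewrite mulrAC.
  under eq_bigr => d _ do rewrite (skew_swap_mul _ (lbr1 al (e_ d)) (lf ga)) -sumrN.
  rewrite exchange_big /=.
  under eq_bigr do under eq_bigr do rewrite mulrAC.
  under eq_bigr => c _ do rewrite sumrN (skew_swap_mul _ (lbr2 al (flat c)) (lf be)) opprK.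
  rewrite exchange_big -sumrN; apply: eq_bigr => d _; rewrite -sumrN; apply: eq_bigr => c _ /=.
  by rewrite [br (flat d) _]lieC // linearN mulrN opprK /=; ring.
have p2 : \sum_c (\sum_d al (e_ d) * be (br (e_ c) (flat d)) * ga (flat c)) = - cyc_term ga al be.
  rewrite exchange_big /=.
  have e d c : al (e_ d) * be (br (e_ c) (flat d)) * ga (flat c)
     = be (br (e_ c) (flat d)) * ga (flat c) * al (e_ d) by ring.
  under eq_bigr do under eq_bigr do rewrite e.
  under eq_bigr => d _ do rewrite (skew_swap_mul _ (lbr1 be (flat d)) (lf ga)) -sumrN.
  rewrite exchange_big -sumrN; apply: eq_bigr => c _; rewrite -sumrN; apply: eq_bigr => d _ /=.
  by congr (- _); ring.
rewrite step p1 p2; ring.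
Qed.
End CyclicIdentity.

(** * Biderivations of polynomial algebras *)

Section Derivations.
Variables (K : fieldType) (S : comAlgType K).

Definition is_derivation (D : S -> S) : Prop :=
  linear D /\ forall f h, D (f * h) = D f * h + f * D h.

Variable pb : S -> S -> S.
Hypothesis pbC : forall f h, pb f h = - pb h f.
Hypothesis pbD : forall f, is_derivation (pb f).

Lemma derivations_bilinear : is_bilinear pb.
Proof.
split=> [h k f f'|f k h h'] /=; last by have [l _] := pbD f; rewrite l.
by rewrite !(pbC _ h); have [-> _] := pbD h; rewrite scalerN -opprD.
Qed.

Definition jacobiator f h k := pb f (pb h k) + pb h (pb k f) + pb k (pb f h).

Lemma jacobiator_cyc f h k : jacobiator f h k = jacobiator h k f.
Proof. by rewrite /jacobiator -[LHS]addrA [LHS]addrC. Qed.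

(** In the last argument the jacobiator is the commutator of two derivations
    minus a derivation. *)
Lemma jacobiator_derivation f h : is_derivation (jacobiator f h).
Proof.
have bb := derivations_bilinear.
have DM x y z : pb x (y * z) = pb x y * z + y * pb x z by have [_ ->] := pbD x.
have jE k : jacobiator f h k = pb f (pb h k) - pb h (pb f k) - pb (pb f h) k.
  by rewrite /jacobiator (pbC k f) (bilNr bb) (pbC k (pb _ _)).
split=> [a k k'|k k'].
  rewrite !jE !(bilDr bb) !(bilZr bb) !scalerBr.
  by rewrite [in RHS]addrACA -opprD; congr (_ - _); rewrite [in RHS]addrACA -opprD.
rewrite !jE !DM !(bilDr bb) !DM; ring.
Qed.
End Derivations.

Section PolynomialDerivations.
Variables (K : fieldType) (n : nat).
Local Notation S := {mpoly K[n]}.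

(** The kernel of a derivation is closed under products, and contains 1. *)
Lemma derivation_eq0 (D : S -> S) : is_derivation D ->
  (forall i, D 'X_i = 0) -> forall f, D f = 0.
Proof.
move=> [Dl DM] DX f.
pose F := HB.pack_for {linear S -> S} D (GRing.isLinear.Build K S S *:%R D Dl).
have D1 : D 1 = 0 by apply: (addrI (D 1)); rewrite -{3}[1]mulr1 DM mulr1 mul1r addr0.
have DXm m : D 'X_[m] = 0.
  rewrite mpolyXE_id; apply: (big_ind (fun x => D x = 0)) => [//|a b Da Db|i _].
    by rewrite DM Da Db mul0r mulr0 addr0.
  by elim: (m i) => [|k IHk]; rewrite ?expr0 // exprS DM DX IHk mul0r mulr0 addr0.
rewrite -[D f]/(F f) (mpolyE f) linear_sum big1 // => m _.
by rewrite linearZ /= DXm scaler0.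
Qed.

Lemma mderiv_X i j : mderiv i ('X_j : S) = (i == j)%:R.
Proof.
rewrite mderivX mnm1E eq_sym; case: eqP => [->|_]; last by rewrite scale0r.
rewrite (_ : (_ - _)%MM = 0%MM) ?mpolyX0 ?scale1r //.
by apply/mnmP => k; rewrite mnmBE subnn mnmE.
Qed.

Lemma derivation_expand (D : S -> S) f : is_derivation D ->
  D f = \sum_i mderiv i f * D 'X_i.
Proof.
move=> [Dl DM]; apply/eqP; rewrite -subr_eq0; apply/eqP.
apply: (derivation_eq0 (D := fun f => D f - \sum_i mderiv i f * D 'X_i)) f => [|j].
  split=> [c f h|f h].
    rewrite Dl scalerBr addrACA -opprD scaler_sumr -big_split /=; congr (_ - _).
    by apply: eq_bigr => i _; rewrite linearP mulrDl scalerAl.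
  rewrite DM mulrBl mulrBr mulr_suml mulr_sumr addrACA -opprD -big_split; congr (_ - _).
  by apply: eq_bigr => i _; rewrite mderivM /=; ring.
rewrite (bigD1 j) //= mderiv_X eqxx mul1r big1 ?addr0 ?subrr // => i ij.
by rewrite mderiv_X (negPf ij) mul0r.
Qed.

Variable c : 'I_n -> 'I_n -> S.
Definition biderivation (f h : S) : S := \sum_i \sum_j mderiv i f * mderiv j h * c i j.

Lemma biderivation_derivation f : is_derivation (biderivation f).
Proof.
split=> [k h h'|h h'].
  rewrite /biderivation scaler_sumr -big_split; apply: eq_bigr => i _ /=.
  rewrite scaler_sumr -big_split; apply: eq_bigr => j _ /=.
  by rewrite linearP mulrDr mulrDl -scalerAr -scalerAl.
rewrite /biderivation mulr_suml mulr_sumr -big_split; apply: eq_bigr => i _ /=.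
rewrite mulr_suml mulr_sumr -big_split; apply: eq_bigr => j _ /=.
by rewrite mderivM; ring.
Qed.

Lemma biderivationX i j : biderivation 'X_i 'X_j = c i j.
Proof.
rewrite /biderivation (bigD1 i) //= (bigD1 j) //= !mderiv_X !eqxx !mul1r.
rewrite [X in _ + X + _]big1 => [|l lj]; last by rewrite !mderiv_X (negPf lj) mulr0 mul0r.
rewrite [X in _ + X]big1 ?addr0 // => k ki.
by rewrite big1 // => l _; rewrite mderiv_X (negPf ki) !mul0r.
Qed.

Hypothesis two : 2%:R != 0 :> K.
Hypothesis c_skew : forall i j, c i j = - c j i.

Lemma biderivationC f h : biderivation f h = - biderivation h f.
Proof.
rewrite /biderivation -sumrN exchange_big; apply: eq_bigr => i _ /=; rewrite -sumrN.
by apply: eq_bigr => j _; rewrite c_skew; ring.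
Qed.

(** A derivation in its last argument, and cyclically invariant, the jacobiator
    vanishes once it does so on variables: they are freed one at a time. *)
Lemma jacobiator_eq0 : (forall i j k, jacobiator biderivation 'X_i 'X_j 'X_k = 0) ->
  forall f h k, jacobiator biderivation f h k = 0.
Proof.
move=> J0.
have J1 i j k : jacobiator biderivation 'X_i 'X_j k = 0.
  exact: (derivation_eq0 (jacobiator_derivation biderivationC biderivation_derivation _ _)).
have J2 i h k : jacobiator biderivation 'X_i h k = 0.
  apply: (derivation_eq0 (jacobiator_derivation biderivationC biderivation_derivation _ _)) => j.
  by rewrite -jacobiator_cyc J1.
move=> f h k.
apply: (derivation_eq0 (jacobiator_derivation biderivationC biderivation_derivation _ _)) => i.
by rewrite -jacobiator_cyc J2.
Qed.

Lemma biderivation_poisson : (forall i j k, jacobiator biderivation 'X_i 'X_j 'X_k = 0) ->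
  is_poisson_bracket biderivation.
Proof.
move=> J0; split; last by move=> f; have [_ DM] := biderivation_derivation f.
split; last exact: jacobiator_eq0.
  exact: (derivations_bilinear biderivationC biderivation_derivation).
move=> f; have : 2%:R *: biderivation f f = 0.
  by rewrite scaler_nat mulr2n {1}biderivationC addNr.
by move/eqP; rewrite scaler_eq0 (negPf two) => /eqP.
Qed.

Lemma poisson_unique (pb : S -> S -> S) : is_poisson_bracket pb ->
  (forall i j, pb 'X_i 'X_j = c i j) -> forall f h, pb f h = biderivation f h.
Proof.
move=> [pbL pbM] pbX f h; have [pbb _ _] := pbL.
have dr f' : is_derivation (pb f') by split; [have [_] := pbb; apply | exact: pbM].
rewrite (derivation_expand h (dr f)) /biderivation exchange_big; apply: eq_bigr => j _ /=.
have -> : pb f 'X_j = \sum_i mderiv i f * pb 'X_i 'X_j.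
  have dl : is_derivation (fun f' => pb f' 'X_j).
    split=> [k u v|u v]; first by rewrite (bilDl pbb) (bilZl pbb).
    by rewrite (lieC pbL) pbM opprD -mulNr -mulrN -!(lieC pbL).
  exact: derivation_expand dl.
by rewrite mulr_sumr; apply: eq_bigr => i _; rewrite pbX; ring.
Qed.
End PolynomialDerivations.

(** * The bracket on the symmetric algebra *)

Section SymmetricAlgebra.
Variables (K : fieldType) (g V : vectType K) (act : g -> V -> V) (rm : 'M[K]_(vdim g)).
Hypothesis actb : is_bilinear act.
Local Notation S := {mpoly K[vdim V]}.
Local Notation sigma := (@sym_inj K V).

Lemma sym_inj_linear : linear sigma.
Proof.
move=> c u v; rewrite /sym_inj scaler_sumr -big_split; apply: eq_bigr => i _ /=.
by rewrite vcoordD vcoordZ scalerDl scalerA.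
Qed.

Lemma sym_inj_bvec i : sigma (bvec i) = 'X_i.
Proof.
rewrite /sym_inj (bigD1 i) //= vcoord_bvec eqxx scale1r big1 ?addr0 // => j ji.
by rewrite vcoord_bvec (negPf ji) scale0r.
Qed.

Definition action_form u v : S := sym_mul (act2 act rm (tens u v)).

Lemma action_formE u v :
  action_form u v = \sum_a sigma (act (bvec a) u) * sigma (act (flat rm a) v).
Proof.
have mb : is_bilinear (fun u v => sigma u * sigma v).
  split=> [w c x y|w c x y] /=; rewrite sym_inj_linear.
    by rewrite mulrDl -scalerAl.
  by rewrite mulrDr -scalerAr.
rewrite /action_form /act2 /sym_mul tlift_tlift {1}/tlift; apply: eq_bigr => a _.
rewrite /flat (bilsuml actb).
pose F := HB.pack_for {linear V -> S} sigma (GRing.isLinear.Build K V S *:%R sigma sym_inj_linear).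
rewrite -[sigma (\sum_b _)]/(F _) linear_sum mulr_sumr; apply: eq_bigr => b _.
rewrite (bilZl actb) linearZ -scalerAr; congr (_ *: _).
rewrite tlift_tmap // tlift_tens //.
split=> [w c x y|w c x y] /=; rewrite (bilDr actb) (bilZr actb) sym_inj_linear.
  by rewrite mulrDl -scalerAl.
by rewrite mulrDr -scalerAr.
Qed.

Lemma action_form_bilinear : is_bilinear action_form.
Proof.
have aE := action_formE.
split=> [w c x y|w c x y] /=; rewrite !aE scaler_sumr -big_split; apply: eq_bigr => a _ /=;
  rewrite (bilDr actb) (bilZr actb) sym_inj_linear.
  by rewrite mulrDl -scalerAl.
by rewrite mulrDr -scalerAr.
Qed.

Hypothesis rm_skew : forall a b, rm a b = - rm b a.

Lemma action_form_skew u v : action_form u v = - action_form v u.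
Proof.
have l w : linear (fun x => sigma (act x w)).
  by move=> c x y; rewrite (bilDl actb) (bilZl actb) sym_inj_linear.
rewrite !action_formE -[RHS]mulr1 -sumrN.
have := skew_swap_mul rm_skew 1 (l u) (l v); under eq_bigr do rewrite mulr1.
move=> ->; rewrite mulr1 sumrN; congr (- _).
by apply: eq_bigr => a _; rewrite mulr1 mulrC.
Qed.

Definition sym_bracket : S -> S -> S :=
  biderivation (fun i j => action_form (bvec i) (bvec j)).

Let brC := @biderivationC _ _ _ (fun i j => action_form_skew (bvec i) (bvec j)).
Let brD := @biderivation_derivation _ _ (fun i j => action_form (bvec i) (bvec j)).

Lemma sym_bracketE u v : sym_bracket (sigma u) (sigma v) = action_form u v.
Proof.
have bb : is_bilinear sym_bracket by exact: (derivations_bilinear brC brD).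
rewrite [in LHS]/sym_inj (bilsuml bb) [in RHS](vcoord_sum u) (bilsuml action_form_bilinear).
apply: eq_bigr => i _; rewrite (bilZl bb) (bilZl action_form_bilinear); congr (_ *: _).
rewrite (bilsumr bb) [in RHS](vcoord_sum v) (bilsumr action_form_bilinear).
apply: eq_bigr => j _; rewrite (bilZr bb) (bilZr action_form_bilinear); congr (_ *: _).
exact: biderivationX.
Qed.

Variable br : g -> g -> g.
Hypothesis brL : is_lie_bracket br.
Hypothesis mod : is_module br act.
Hypothesis rel : forall a b w, act (br (flat rm a) (flat rm b)) w
  = \sum_c (op_mx (br (bvec c)) *m rm + rm *m (op_mx (br (bvec c)))^T) a b *: act (flat rm c) w.

(** Expanding {u, {v, w}} by the Leibniz rule gives a sum T in which the two
    operators from g hit w and one in which they hit v; the latter is -T with v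
    and w exchanged, by skewness. The six terms of the Jacobi sum pair off into
    commutators, which are the three terms of [cyc_term_sum]. *)
Lemma sym_bracket_jacobi u v w : jacobiator sym_bracket (sigma u) (sigma v) (sigma w) = 0.
Proof.
have DM x y z : sym_bracket x (y * z) = sym_bracket x y * z + y * sym_bracket x z.
  by have [_] := brD x; apply.
pose F := HB.pack_for {linear V -> S} sigma (GRing.isLinear.Build K V S *:%R sigma sym_inj_linear).
have lact z : linear (fun x => sigma (act x z)).
  by move=> c x y; rewrite (bilDl actb) (bilZl actb) sym_inj_linear.
pose ev z := HB.pack_for {linear g -> S} (fun x => sigma (act x z))
  (GRing.isLinear.Build K g S *:%R _ (lact z)).
pose T x y z := \sum_a \sum_b sigma (act (bvec b) x) * sigma (act (bvec a) y)
  * sigma (act (flat rm b) (act (flat rm a) z)).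
have double x y z : sym_bracket (sigma x) (sym_bracket (sigma y) (sigma z)) = T x y z - T x z y.
  have bb : is_bilinear sym_bracket by exact: (derivations_bilinear brC brD).
  rewrite (sym_bracketE y z) action_formE (bilsumr bb).
  under eq_bigr do rewrite DM !sym_bracketE !action_formE mulr_suml mulr_sumr.
  rewrite big_split [RHS]addrC /=; congr (_ + _); last first.
    by apply: eq_bigr => a _; apply: eq_bigr => b _; ring.
  rewrite exchange_big /T [in RHS]exchange_big -sumrN; apply: eq_bigr => b _ /=.
  have l1 : linear (fun p => sigma (act (flat rm b) (act p y))).
    by move=> c p q; rewrite (bilDl actb) (bilZl actb) (bilDr actb) (bilZr actb) sym_inj_linear.
  have := skew_swap_mul rm_skew (sigma (act (bvec b) x)) l1 (lact z).
  set A := \sum_a _; set B := \sum_a _ => AB.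
  transitivity A; first by apply: eq_bigr => a _; ring.
  by rewrite AB; congr (- _); apply: eq_bigr => a _; ring.
have comm x y z : T x y z - T y x z = cyc_term br rm (ev x) (ev y) (ev z).
  rewrite /T exchange_big -sumrB; apply: eq_bigr => a _ /=.
  rewrite -sumrB; apply: eq_bigr => b _.
  have [_ ->] := mod; rewrite -[sigma (_ - _)]/(F _) linearB /=; ring.
have cyc := @cyc_term_sum K g br S rm brL rm_skew (ev u) (ev v) (ev w).
rewrite /jacobiator !double -[RHS]cyc -?comm; first by ring.
move=> a b; rewrite /= rel -[sigma _]/(F _) linear_sum; apply: eq_bigr => c _.
by rewrite linearZ.
Qed.
End SymmetricAlgebra.

Theorem theorem4p1 (R : realType) (g V : vectType R[i])
    (br : g -> g -> g) (delta : {linear g -> tensor g g}) (r : tensor g g)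
    (act : g -> V -> V)
    (Delta : {linear (g * V)%type -> tensor (g * V)%type (g * V)%type}) :
  is_quasitriangular br delta r ->
  is_semidirect_lie_bialgebra br delta act Delta ->
  exists! pb : symalg V -> symalg V -> symalg V,
    is_poisson_bracket pb /\
    forall u v : V,
      pb (sym_inj u) (sym_inj v) = sym_mul (act2 act (rminus r) (tens u v)).
Proof.
move=> quasi semid.
have [ss mod _ _ _] := semid; have [brL _] := ss; have [actb _] := mod.
have skew := rminus_skew r.
have rel a b w : act (br (flat (rminus r) a) (flat (rminus r) b)) w
  = \sum_c (op_mx (br (bvec c)) *m rminus r + rminus r *m (op_mx (br (bvec c)))^T) a b
      *: act (flat (rminus r) c) w.
  have rE c : rflat act r c = op_mx (act (flat (rminus r) c)).
    apply/matrixP => i j; rewrite /rflat /flat summxE mxE (bilsuml actb) vcoord_sumE.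
    by apply: eq_bigr => d _; rewrite (bilZl actb) vcoordZ !mxE.
  have := rflat_mx_commutator quasi semid a b; rewrite !rE -(op_mx_bracket mod) => e.
  apply: vec_ext => i; rewrite (op_mx_act actb) e vcoord_sumE.
  under eq_bigr do rewrite summxE mulr_suml.
  rewrite exchange_big; apply: eq_bigr => c _ /=; rewrite vcoordZ (op_mx_act actb) mulr_sumr.
  by apply: eq_bigr => j _; rewrite [X in X * _ = _]mxE rE mulrA.
have two : 2%:R != 0 :> R[i] by rewrite pnatr_eq0.
exists (sym_bracket act (rminus r)); split.
  split; last by move=> u v; apply: sym_bracketE.
  apply: biderivation_poisson => [//|i j|i j k]; first exact: action_form_skew.
  rewrite -!sym_inj_bvec; exact: (sym_bracket_jacobi actb skew brL mod rel).
move=> pb [pbP pbE]; apply/funext => f; apply/funext => h; apply/esym.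
apply: poisson_unique => // i j; rewrite -!sym_inj_bvec; exact: pbE.
Qed.
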